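(* For $f\in\mathcal{S}(\mathbb{R}^n)$ define the periodization $\mathcal{P}f:\mathbb{R}^n\to\mathbb{C}$ by $$\mathcal{P}f(x):=\sum_{k\in\mathbb{Z}^n}f(x+2\pi k).$$ Then $\mathcal{P}:\mathcal{S}(\mathbb{R}^n)\to C^\infty(\mathbb{T}^n)$ is surjective and $\|\mathcal{P}f\|_{L^1(\mathbb{T}^n)}\le\|f\|_{L^1(\mathbb{R}^n)}$ for all $f\in\mathcal{S}(\mathbb{R}^n)$. Moreover, for all $f\in\mathcal{S}(\mathbb{R}^n)$, $$\mathcal{P}f(x)=\mathcal{F}_{\mathbb{T}^n}^{-1}\bigl((\mathcal{F}_{\mathbb{R}^n}f)|_{\mathbb{Z}^n}\bigr)(x)$$ and $$\sum_{k\in\mathbb{Z}^n}f(x+2\pi k)=\sum_{\xi\in\mathbb{Z}^n}e^{ix\cdot\xi}\,(\mathcal{F}_{\mathbb{R}^n}f)(\xi).$$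
   Context: $\mathbb{T}^n=(\mathbb{R}/2\pi\mathbb{Z})^n$; functions on $\mathbb{T}^n$ are identified with $2\pi$-periodic functions on $\mathbb{R}^n$, and the measure on $\mathbb{T}^n$ with the restriction of the Euclidean measure to the cube $[0,2\pi)^n$ (the same normalisation is used for $L^1(\mathbb{T}^n)$ and $L^1(\mathbb{R}^n)$). $\mathcal{S}(\mathbb{R}^n)$ is the Schwartz space. $(\mathcal{F}_{\mathbb{R}^n}f)(\xi)=\int_{\mathbb{R}^n}e^{-ix\cdot\xi}f(x)\,(2\pi)^{-n}\mathrm{d}x$. $\mathcal{F}_{\mathbb{T}^n}:C^\infty(\mathbb{T}^n)\to\mathcal{S}(\mathbb{Z}^n)$, $(\mathcal{F}_{\mathbb{T}^n}g)(\xi)=\int_{\mathbb{T}^n}e^{-ix\cdot\xi}g(x)\,(2\pi)^{-n}\mathrm{d}x$, is a bijection onto the space $\mathcal{S}(\mathbb{Z}^n)$ of rapidly decaying functions on $\mathbb{Z}^n$, with inverse $(\mathcal{F}_{\mathbb{T}^n}^{-1}h)(x)=\sum_{\xi\in\mathbb{Z}^n}e^{ix\cdot\xi}h(\xi)$. *)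

(* Defs.v *)
From HB Require Import structures.
From mathcomp Require Import all_boot all_order all_algebra.
From mathcomp Require Import complex.
From mathcomp Require Import all_classical all_reals all_analysis.
From mathcomp Require Import showcase.summability.
Set Implicit Arguments.
Unset Strict Implicit.
Unset Printing Implicit Defensive.
Import Order.TTheory GRing.Theory Num.Theory.
Import numFieldNormedType.Exports.
Local Open Scope classical_set_scope.
Local Open Scope complex_scope.
Local Open Scope ring_scope.

(* Lebesgue measure on R^n, carried by [n.-tuple R] with its product
   sigma-algebra: the iterated product of the Lebesgue measure of R, transported
   along the identification (x, t) |-> x :: t of R * R^n with R^n.+1. *)
Section lebesgue_measure_tuple.
Context (R : realType).
Local Notation RT := (measurableTypeR R).

Definition tcons n (p : RT * n.-tuple RT) : n.+1.-tuple RT :=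
  [tuple of p.1 :: p.2].

Lemma measurable_tcons n : measurable_fun setT (@tcons n).
Proof. exact: measurable_cons. Qed.

Section step.
Variables (n : nat) (mu : {sigma_finite_measure set (n.-tuple RT) -> \bar R}).

Definition tuple_measureS : set (n.+1.-tuple RT) -> \bar R :=
  pushforward (@lebesgue_measure R \x mu)%E (@tcons n).

Let mpre (A : set (n.+1.-tuple RT)) : measurable A ->
  measurable (@tcons n @^-1` A).
Proof. by move=> mA; rewrite -[X in measurable X]setTI; exact: measurable_tcons. Qed.

Let tuple_measureS0 : tuple_measureS set0 = 0%E.
Proof. by rewrite /tuple_measureS /pushforward preimage_set0 measure0. Qed.

Let tuple_measureS_ge0 A : (0 <= tuple_measureS A)%E.
Proof. exact: (measure_ge0 (@lebesgue_measure R \x mu)%E). Qed.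

Let tuple_measureS_sigma_additive : semi_sigma_additive tuple_measureS.
Proof.
move=> F mF tF mUF; rewrite /tuple_measureS /pushforward preimage_bigcup.
apply: measure_semi_sigma_additive.
- by move=> k; exact: mpre.
- apply/trivIsetP => /= i j _ _ ij; rewrite -preimage_setI.
  by move/trivIsetP : tF => /(_ _ _ _ _ ij) ->//; rewrite preimage_set0.
- by rewrite -preimage_bigcup; exact: mpre.
Qed.

HB.instance Definition _ := isMeasure.Build _ _ _ tuple_measureS
  tuple_measureS0 tuple_measureS_ge0 tuple_measureS_sigma_additive.

Let tuple_measureS_sigma_finite : sigma_finite setT tuple_measureS.
Proof.
have /sigma_finiteP[F [TF ndF Foo]] := sigma_finiteT (@lebesgue_measure R).
have /sigma_finiteP[G [TG ndG Goo]] := sigma_finiteT mu.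
pose H k := [set t : n.+1.-tuple RT | F k (thead t) /\ G k [tuple of behead t]].
have HE k : @tcons n @^-1` H k = F k `*` G k.
  apply/seteqP; split => -[x t] /= [Fx]; rewrite /tcons /=.
    by rewrite (_ : [tuple of _] = t)//; exact: val_inj.
  by move=> Gt; split=> //=; rewrite (_ : [tuple of _] = t)//; exact: val_inj.
exists H.
  apply/esym; rewrite -subTset => t _.
  have [i _ Fi] : (\bigcup_i F i) (thead t) by rewrite -TF.
  have [j _ Gj] : (\bigcup_i G i) [tuple of behead t] by rewrite -TG.
  exists (maxn i j) => //; split.
    by move: Fi; exact/subsetPset/ndF/leq_maxl.
  by move: Gj; exact/subsetPset/ndG/leq_maxr.
move=> k; have [mF Fk] := Foo k; have [mG Gk] := Goo k; split.
  apply: measurableI.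
    rewrite -[X in measurable X]setTI.
    exact: (@measurable_tnth _ RT n.+1 ord0).
  rewrite -[X in measurable X]setTI.
  exact: (@measurable_behead _ RT n).
rewrite /tuple_measureS /pushforward HE product_measure1E//.
by rewrite lte_mul_pinfty// ge0_fin_numE.
Qed.

HB.instance Definition _ := Measure_isSigmaFinite.Build _ _ _ tuple_measureS
  tuple_measureS_sigma_finite.

End step.

Fixpoint lebesgue_tuple n : {sigma_finite_measure set (n.-tuple RT) -> \bar R} :=
  match n with
  | 0 => dirac ([tuple] : 0.-tuple RT)
  | m.+1 => tuple_measureS (lebesgue_tuple m)
  end.

End lebesgue_measure_tuple.

Section periodization.
Context (R : realType) (n : nat).
Local Notation C := R[i].
Local Notation Rn := 'rV[R]_n.
Local Notation Zn := 'rV[int]_n.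

Definition cmod (z : C) : R := ComplexField.Normc.normc z.

Definition expi (t : R) : C := cos t +i* sin t.

Definition dotp (x y : Rn) : R := \sum_i x 0 i * y 0 i.

Definition ZnR (k : Zn) : Rn := map_mx intr k.

(* The analysis library puts no normed module structure over R on R[i]:
   derivatives, integrals and sums of complex-valued functions are taken on the
   real and imaginary parts. *)
Definition partial (i : 'I_n) (f : Rn -> C) : Rn -> C := fun x =>
  'D_(delta_mx 0 i) (@complex.Re R \o f) x +i*
  'D_(delta_mx 0 i) (@complex.Im R \o f) x.

(* [:: i1; ...; ik] stands for d_i1 (... (d_ik f)). *)
Definition partials (s : seq 'I_n) (f : Rn -> C) : Rn -> C :=
  foldr partial f s.

Definition continuous_derivable (g : Rn -> R) : Prop :=
  continuous g /\ forall (i : 'I_n) x, derivable g x (delta_mx 0 i).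

(* C^oo: all iterated partial derivatives, of all orders and in every order of
   differentiation, exist and are continuous. *)
Definition smooth : set (Rn -> C) := [set f | forall s : seq 'I_n,
  continuous_derivable (@complex.Re R \o partials s f) /\
  continuous_derivable (@complex.Im R \o partials s f)].

Definition monomial (a : 'I_n -> nat) (x : Rn) : R := \prod_i x 0 i ^+ a i.

Definition schwartz : set (Rn -> C) := [set f | smooth f /\
  forall (a : 'I_n -> nat) (s : seq 'I_n), exists M : R, forall x,
    `|monomial a x| * cmod (partials s f x) <= M].

Definition smooth_torus : set (Rn -> C) := [set g | smooth g /\
  forall (x : Rn) (k : Zn), g (x + (2 * pi) *: ZnR k) = g x].

Definition japanese (x : Rn) : R := Num.sqrt (1 + dotp x x).

Definition schwartzZ : set (Zn -> C) := [set h |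
  forall N : nat, exists M : R, forall k,
    japanese (ZnR k) ^+ N * cmod (h k) <= M].

(* Unordered sum over Z^n: limit of the partial sums over finite sets of
   indices, directed by inclusion. *)
Definition sumZ (a : Zn -> C) : C :=
  summability.sum (@complex.Re R \o a) +i*
  summability.sum (@complex.Im R \o a).

Definition abs_summable (a : Zn -> C) : Prop :=
  esum.summable setT (fun k => (cmod (a k))%:E).

Definition row_of_tuple (t : n.-tuple (measurableTypeR R)) : Rn :=
  \row_i tnth t i.

Definition cube : set Rn := [set x | forall i, 0 <= x 0 i < 2 * pi].

Definition cintegral (D : set Rn) (f : Rn -> C) : C :=
  (\int[@lebesgue_tuple R n]_(t in row_of_tuple @^-1` D)
     complex.Re (f (row_of_tuple t))) +i*
  (\int[@lebesgue_tuple R n]_(t in row_of_tuple @^-1` D)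
     complex.Im (f (row_of_tuple t))).

Definition L1norm (D : set Rn) (f : Rn -> C) : \bar R :=
  (\int[@lebesgue_tuple R n]_(t in row_of_tuple @^-1` D)
     (cmod (f (row_of_tuple t)))%:E)%E.

Definition fourierR (f : Rn -> C) : Rn -> C := fun xi =>
  cintegral setT (fun x => expi (- dotp x xi) * f x * ((2 * pi) ^- n)%:C).

Definition fourierT (g : Rn -> C) : Zn -> C := fun xi =>
  cintegral cube
    (fun x => expi (- dotp x (ZnR xi)) * g x * ((2 * pi) ^- n)%:C).

(* Inverse of the bijection fourierT : C^oo(T^n) -> S(Z^n); 0 outside the image
   of C^oo(T^n). *)
Definition fourierT_inv : (Zn -> C) -> (Rn -> C) :=
  'pinv_(fun=> fun=> 0) smooth_torus fourierT.

Definition periodization (f : Rn -> C) : Rn -> C := fun x =>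
  sumZ (fun k => f (x + (2 * pi) *: ZnR k)).

End periodization.

(* Main.v *)
(** Every derivative of a Schwartz function [f] is bounded on the translates
    [x + 2 pi k] by a multiple of the summable weight [prod_i 1/(1 + k_i^2)],
    locally uniformly in [x], so that the periodization can be differentiated
    term by term.  It is onto because the sigmoid [s] yields a Schwartz function
    [s x - s (x - 2 pi)] whose translates by [2 pi Z] telescope to 1: a torus
    function [g] is the periodization of [g] times a product of such functions.
    Tiling R^n by the translates of the cube gives the L^1 bound and identifies
    the Fourier coefficients of the periodization with the values at integer
    points of the Fourier transform.  Finally, the Fourier coefficients of a
    smooth torus function decay rapidly, so its Fourier series converges to a
    continuous function with the same coefficients, and a continuous periodic
    function is determined by its coefficients (averaging against the Fejer
    kernel). *)
Require Import Defs.
From mathcomp Require Import all_boot all_order all_algebra.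
From mathcomp Require Import complex.
From mathcomp Require Import all_classical all_reals all_analysis.
From mathcomp Require Import showcase.summability.
From mathcomp Require Import finmap measurable_realfun.
From mathcomp Require Import ring lra zify.
Set Implicit Arguments.
Unset Strict Implicit.
Unset Printing Implicit Defensive.
Import Order.TTheory GRing.Theory Num.Theory.
Import numFieldNormedType.Exports.
Local Open Scope classical_set_scope.
Local Open Scope complex_scope.
Local Open Scope ring_scope.
(** * Weighted sums over the lattice *)

(** Interchanges of limits with the unordered sums over Z^n all rest on one quantitative fact: for
    each error there is a finite box that serves every sequence dominated by a multiple of the
    weight. Uniformity in the sequence is uniformity in the point x, and it yields linearity,
    shifts, continuity and term-by-term differentiation with explicit errors. Iterated derivatives
    are never computed: smoothness is proved by coinduction, on a class of continuous functions
    closed under partial derivation. Hence the sigmoid: it solves s' = s (1 - s), so its derivatives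
    are polynomials in s and the class is explicit, which a compactly supported cutoff would not
    give. On the torus, invariance of the integral over the cube under translation replaces
    integration by parts, both for the orthogonality of characters and for the coefficients of a
    derivative. Rapid decay of the transform of f is derived at integer points, as that of the
    coefficients of a smooth periodic function. *)

Section complex_modulus.
Context (R : realType).
Local Notation C := R[i].
Implicit Types z w : C.

Lemma cmodE z : (cmod z)%:C = `|z|.
Proof. by []. Qed.

Lemma cmod_ge0 z : 0 <= cmod z.
Proof. by case: z => a b; exact: sqrtr_ge0. Qed.

Lemma cmodD z w : cmod (z + w) <= cmod z + cmod w.
Proof. exact: le_normcD. Qed.

Lemma cmodM z w : cmod (z * w) = cmod z * cmod w.
Proof. exact: ComplexField.Normc.normcM. Qed.

Lemma cmodN z : cmod (- z) = cmod z.
Proof. exact: normcN. Qed.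

Lemma cmodB z w : cmod (z - w) <= cmod z + cmod w.
Proof. by rewrite -(cmodN w) cmodD. Qed.

Lemma cmodBC z w : cmod (z - w) = cmod (w - z).
Proof. by rewrite -cmodN opprB. Qed.

Lemma cmod0 : cmod (0 : C) = 0.
Proof. exact: ComplexField.Normc.normc0. Qed.

Lemma cmod_eq0 z : cmod z = 0 -> z = 0.
Proof. exact: ComplexField.Normc.eq0_normc. Qed.

Lemma cmodR (x : R) : cmod x%:C = `|x|.
Proof. by rewrite /cmod /= expr0n/= addr0 sqrtr_sqr. Qed.

Lemma cmod_Re z : `|complex.Re z| <= cmod z.
Proof.
by case: z => a b; rewrite /cmod /= -sqrtr_sqr ler_wsqrtr// lerDl sqr_ge0.
Qed.

Lemma cmod_Im z : `|complex.Im z| <= cmod z.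
Proof.
by case: z => a b; rewrite /cmod /= -sqrtr_sqr ler_wsqrtr// lerDr sqr_ge0.
Qed.

Lemma cmod_leD z : cmod z <= `|complex.Re z| + `|complex.Im z|.
Proof.
case: z => a b; rewrite /cmod /=.
rewrite -[leRHS]ger0_norm ?addr_ge0// -[leRHS]sqrtr_sqr ler_wsqrtr//.
rewrite sqrrD !real_normK ?num_real// lerD2r lerDl.
by rewrite mulrn_wge0// mulr_ge0.
Qed.

Lemma cmod_dist_triangle z1 z2 z3 :
  cmod (z1 - z3) <= cmod (z1 - z2) + cmod (z2 - z3).
Proof. by rewrite (le_trans _ (cmodD _ _))// subrKA. Qed.

Lemma cmod_sum (I : Type) (r : seq I) (P : pred I) (F : I -> C) :
  cmod (\sum_(i <- r | P i) F i) <= \sum_(i <- r | P i) cmod (F i).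
Proof.
elim/big_ind2 : _ => [|x1 x2 y1 y2 h1 h2|//]; first by rewrite cmod0.
by rewrite (le_trans (cmodD _ _))// lerD.
Qed.

Lemma eq_cmod_small z w : (forall e : R, 0 < e -> cmod (z - w) <= e) -> z = w.
Proof.
move=> h; apply/eqP; rewrite -subr_eq0; apply/eqP/cmod_eq0.
apply/eqP; rewrite eq_le cmod_ge0 andbT; apply/ler_addgt0Pl => e e0.
by rewrite addr0 h.
Qed.

Lemma Re_add z w : complex.Re (z + w) = complex.Re z + complex.Re w.
Proof. by case: z; case: w. Qed.

Lemma Im_add z w : complex.Im (z + w) = complex.Im z + complex.Im w.
Proof. by case: z; case: w. Qed.

Lemma Re_opp z : complex.Re (- z) = - complex.Re z.
Proof. by case: z. Qed.

Lemma Im_opp z : complex.Im (- z) = - complex.Im z.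
Proof. by case: z. Qed.

Lemma Re_mul z w : complex.Re (z * w) =
  complex.Re z * complex.Re w - complex.Im z * complex.Im w.
Proof. by case: z; case: w. Qed.

Lemma Im_mul z w : complex.Im (z * w) =
  complex.Re z * complex.Im w + complex.Im z * complex.Re w.
Proof. by case: z; case: w. Qed.

Lemma Re_sum (I : Type) (r : seq I) (P : pred I) (F : I -> C) :
  complex.Re (\sum_(i <- r | P i) F i) = \sum_(i <- r | P i) complex.Re (F i).
Proof. by apply: (big_morph _ Re_add). Qed.

Lemma Im_sum (I : Type) (r : seq I) (P : pred I) (F : I -> C) :
  complex.Im (\sum_(i <- r | P i) F i) = \sum_(i <- r | P i) complex.Im (F i).
Proof. by apply: (big_morph _ Im_add). Qed.

Lemma complexP z w : complex.Re z = complex.Re w ->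
  complex.Im z = complex.Im w -> z = w.
Proof. by case: z => a b; case: w => c d /= -> ->. Qed.

Lemma expiD (s t : R) : expi (s + t) = expi s * expi t.
Proof. by rewrite /expi cosD sinD; apply: complexP => //=; ring. Qed.

Lemma expi0 : expi (0 : R) = 1.
Proof. by rewrite /expi cos0 sin0. Qed.

Lemma expiN (t : R) : expi (- t) = conjc (expi t).
Proof. by rewrite /expi cosN sinN. Qed.

Lemma expiK (t : R) : expi t * expi (- t) = 1.
Proof. by rewrite -expiD subrr expi0. Qed.

Lemma cmod_expi (t : R) : cmod (expi t) = 1.
Proof. by rewrite /cmod /= cos2Dsin2 sqrtr1. Qed.

Lemma expi_pi : expi (pi : R) = -1.
Proof. by rewrite /expi cospi sinpi; apply: complexP; rewrite /= ?oppr0. Qed.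

Lemma expi_period (m : int) : expi (m%:~R * (2 * pi) : R) = 1.
Proof.
have e2 : expi (2 * pi : R) = 1.
  by rewrite mulr_natl mulr2n expiD expi_pi mulrNN mulr1.
have en k : expi (k%:R * (2 * pi) : R) = 1.
  elim: k => [|k IH]; first by rewrite mul0r expi0.
  by rewrite -addn1 natrD mulrDl expiD IH mul1r mul1r e2.
case: m => m; first exact: en.
by rewrite NegzE mulrNz mulNr expiN en; apply: complexP; rewrite /= ?oppr0.
Qed.

End complex_modulus.

#[local] Existing Instance summability.totally_filter.

(** * Boxes in Z^n and unordered sums with uniform tails *)

Section lattice_sums.
Context (R : realType) (n : nat).
Local Notation C := R[i].
Local Notation Zn := 'rV[int]_n.

(** The product form makes the sum over a box the n-th power of a one-dimensional sum. *)
Definition weight (k : Zn) : R := \prod_i (1 + (k 0 i)%:~R ^+ 2)^-1.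

Lemma weight_gt0 k : 0 < weight k.
Proof. by apply: prodr_gt0 => i _; rewrite invr_gt0 ltr_pwDl// sqr_ge0. Qed.

(** Points of the cube of side 2m+1 centred at 0 are coded by finite functions, so that sums of
    products over a box factor by distributivity. *)
Definition boxpt m (f : {ffun 'I_n -> 'I_(m.*2.+1)}) : Zn :=
  \row_i ((f i)%:Z - m%:Z).

Lemma boxpt_inj m : injective (@boxpt m).
Proof.
move=> f g /rowP fg; apply/ffunP => i; have := fg i; rewrite !mxE.
by move=> /(addIr _) [] /val_inj.
Qed.

Definition box m : {fset Zn} :=
  [fset @boxpt m f | f in [set: {ffun 'I_n -> 'I_(m.*2.+1)}]%SET]%fset.

Lemma mem_box m k : (k \in box m) = [forall i, (`|k 0%R i| <= m)%N].
Proof.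
apply/imfsetP/forallP => /= [[f _ ->] i|km].
  rewrite mxE; have := ltn_ord (f i); rewrite ltnS; lia.
have h i : (`|(k 0%R i + m%:Z)%R| < m.*2.+1)%N.
  by move: (km i); move: (k 0%R i) => z; lia.
exists [ffun i => Ordinal (h i)]; first by rewrite inE.
apply/rowP => i; rewrite mxE ffunE /=; have := km i; lia.
Qed.

Lemma big_box (V : zmodType) m (a : Zn -> V) :
  \sum_(k <- box m) a k = \sum_(f : {ffun 'I_n -> 'I_(m.*2.+1)}) a (boxpt f).
Proof.
rewrite big_imfset/=; last by move=> ? ? _ _ /boxpt_inj.
by rewrite big_enum/=; apply: eq_bigl => f; rewrite inE.
Qed.

Lemma box_subset m m' : (m <= m')%N -> (box m `<=` box m')%fset.
Proof.
move=> mm; apply/fsubsetP => k; rewrite !mem_box => /forallP h.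
by apply/forallP => i; exact: leq_trans (h i) mm.
Qed.

Lemma fset_sub_box (J : {fset Zn}) : exists m, (J `<=` box m)%fset.
Proof.
exists (\max_(k <- J) \max_i `|k 0%R i|)%N; apply/fsubsetP => k kJ.
rewrite mem_box; apply/forallP => i.
rewrite (@leq_trans (\max_i `|k 0%R i|))%N ?(leq_bigmax_cond i)//.
by apply: (@leq_bigmax_seq _ _ xpredT (fun k : Zn => \max_i `|k 0%R i|)%N).
Qed.

(** The correction [4 / m.+1%:R] makes the induction close: each of the two new terms, at [m.+1] and
    its opposite, is at most 2/(x(x+1)) = 2/x - 2/(x+1) with x = m+1, and these telescope. The 5 is
    fixed by the case m = 0, where the sum is 1. *)
Lemma sum_inv1Dsq m :
  \sum_(j < m.*2.+1) (1 + ((j%:Z - m%:Z)%:~R : R) ^+ 2)^-1 <=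
  5 - 4 / m.+1%:R.
Proof.
elim: m => [|m IH].
  by rewrite big_ord_recl big_ord0 /= subrr expr0n/= !addr0; lra.
rewrite doubleS big_ord_recl big_ord_recr/=.
rewrite (eq_bigr (fun j : 'I_(m.*2.+1) =>
    (1 + ((j%:Z - m%:Z)%:~R : R) ^+ 2)^-1)); last first.
  move=> j _; rewrite /bump/= add1n; congr (_ + _ ^+ 2)^-1; congr (_%:~R); lia.
have -> : ((0%N%:Z - m.+1%:Z)%:~R : R) = - m.+1%:R.
  by rewrite sub0r mulrNz.
have -> : (((bump 0 m.*2.+1)%:Z - m.+1%:Z)%:~R : R) = m.+1%:R.
  by rewrite (_ : _ - _ = m.+1%:Z)// /bump/=; lia.
rewrite sqrrN.
have h (x : R) : 1 <= x -> (1 + x ^+ 2)^-1 <= 2 / x - 2 / (x + 1).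
  move=> x1; have -> : 2 / x - 2 / (x + 1) = 2 / (x * (x + 1)).
    by field; apply/andP; split; apply: lt0r_neq0; lra.
  rewrite -[leLHS]mul1r ler_pdivrMr; last by nra.
  rewrite mulrAC ler_pdivlMr; last by nra.
  by nra.
have := h m.+1%:R; rewrite natr1 ler1n => /(_ erefl) hm.
have e4 (x : R) : 4 / x = 2 * (2 / x) by rewrite mulrA -natrM.
move: IH hm; rewrite !e4.
set u := 2 / _; set v := 2 / _; set s := \sum_(_ < _) _; set w := (1 + _)^-1.
lra.
Qed.

Lemma sum_box_weight m : \sum_(k <- box m) weight k <= 5 ^+ n.
Proof.
rewrite big_box.
under eq_bigr do (rewrite /weight; under eq_bigr do rewrite mxE).
rewrite -(bigA_distr_bigA
  (fun _ (j : 'I_(m.*2.+1)) => (1 + ((j%:Z - m%:Z)%:~R : R) ^+ 2)^-1)) /=.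
rewrite -[X in _ ^+ X]card_ord -prodr_const ler_prod// => i _.
rewrite sumr_ge0/=; last by move=> j _; rewrite invr_ge0 addr_ge0// sqr_ge0.
by rewrite (le_trans (sum_inv1Dsq m))// gerBl.
Qed.

Lemma big_fsetD_subset (V : zmodType) (F : Zn -> V) (A B : {fset Zn}) :
  (A `<=` B)%fset ->
  \sum_(k <- B) F k = \sum_(k <- A) F k + \sum_(k <- (B `\` A)%fset) F k.
Proof.
move=> AB; rewrite [LHS](big_fsetID _ (mem A))/=; congr (_ + _).
  rewrite (_ : [fset x | x in B & x \in A]%fset = A)//.
  apply/fsetP => x; rewrite !inE/= andbC.
  by case: (boolP (x \in A)) => //= xA; exact: (fsubsetP AB).
rewrite (_ : [fset x | x in B & x \notin A]%fset = (B `\` A)%fset)//.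
by apply/fsetP => x; rewrite !inE/= andbC.
Qed.

Lemma ler_sum_fsubset (F : Zn -> R) (A B : {fset Zn}) :
  (forall k, 0 <= F k) -> (A `<=` B)%fset ->
  \sum_(k <- A) F k <= \sum_(k <- B) F k.
Proof.
by move=> F0 AB; rewrite (big_fsetD_subset F AB) lerDl; apply: sumr_ge0.
Qed.

Lemma sum_fset_weight (J : {fset Zn}) : \sum_(k <- J) weight k <= 5 ^+ n.
Proof.
have [m Jm] := fset_sub_box J.
rewrite (le_trans _ (sum_box_weight m))// ler_sum_fsubset// => k.
exact/ltW/weight_gt0.
Qed.

(** All finite sums are at most [5 ^+ n], hence have a supremum. Once a box contains a finite set
    whose sum is within e of it, no larger set can add more than e. *)
Lemma weight_tail (e : R) : 0 < e -> exists m, forall J : {fset Zn},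
  (box m `<=` J)%fset -> \sum_(k <- (J `\` box m)%fset) weight k <= e.
Proof.
move=> e0; pose E := [set \sum_(k <- J) weight k | J in [set: {fset Zn}]].
have hE : has_sup E.
  split; first by exists (\sum_(k <- fset0) weight k); exists fset0.
  by exists (5 ^+ n) => _ [J _ <-]; exact: sum_fset_weight.
have [_ [J _ <-] hJ] := sup_adherent e0 hE.
have [m Jm] := fset_sub_box J; exists m => K mK.
have : \sum_(k <- K) weight k <= sup E.
  by apply: ub_le_sup; [exact: hE.2|exists K].
rewrite (big_fsetD_subset _ mK).
have : \sum_(k <- J) weight k <= \sum_(k <- box m) weight k.
  by apply: ler_sum_fsubset => // k; exact/ltW/weight_gt0.
lra.
Qed.

Lemma weight_cauchy (e : R) : 0 < e -> exists m, forall (a : Zn -> R) (A : R),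
  (forall k, `|a k| <= A * weight k) -> forall J : {fset Zn},
  (box m `<=` J)%fset ->
  `|\sum_(k <- J) a k - \sum_(k <- box m) a k| <= A * e.
Proof.
move=> e0; have [m hm] := weight_tail e0; exists m => a A aA J mJ.
rewrite (big_fsetD_subset _ mJ) addrAC subrr add0r.
have A0 : 0 <= A.
  have := le_trans (normr_ge0 _) (aA 0); rewrite pmulr_lge0//.
  exact: weight_gt0.
rewrite (le_trans (ler_norm_sum _ _ _))// (le_trans (ler_sum _ (fun i _ => aA i)))//.
by rewrite -mulr_sumr ler_wpM2l// hm.
Qed.

Lemma partial_sumE (a : Zn -> R) (J : {fset Zn}) :
  summability.partial_sum a J = \sum_(k <- J) a k.
Proof. by rewrite /partial_sum big_seq_fsetE. Qed.

Lemma rsum_approx (e : R) : 0 < e -> exists m, forall (a : Zn -> R) (A : R),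
  (forall k, `|a k| <= A * weight k) -> forall J : {fset Zn},
  (box m `<=` J)%fset ->
  `|summability.sum a - \sum_(k <- J) a k| <= A * e.
Proof.
move=> e0; have e20 : 0 < e / 2 by rewrite divr_gt0.
have [m hm] := weight_cauchy e20; exists m => a A aA J mJ.
have A0 : 0 <= A.
  have := le_trans (normr_ge0 _) (aA 0); rewrite pmulr_lge0//.
  exact: weight_gt0.
have cva : cvg (summability.partial_sum a @ totally).
  apply/cauchy_cvgP/cauchy_exP => d d0.
  (* Dividing by [A + 1] rather than [A] covers the case A = 0; the same device recurs below. *)
  have d' : 0 < d / (A + 1) by rewrite divr_gt0// ltr_wpDl.
  have [m' hm'] := weight_cauchy d'.
  exists (\sum_(k <- box m') a k); exists (box m') => //= K /= mK.
  rewrite /ball/= partial_sumE distrC (le_lt_trans (hm' _ _ aA _ mK))//.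
  by rewrite mulrCA gtr_pMr// ltr_pdivrMr ?mul1r ?ltrDl// ltr_wpDl.
have h0 : \forall K \near totally,
    `|summability.partial_sum a K - \sum_(k <- J) a k| <= A * e.
  exists (box m) => //= K /= mK; rewrite partial_sumE.
  rewrite (le_trans (ler_distD (\sum_(k <- box m) a k) _ _))//.
  rewrite [A * e](_ : _ = A * (e / 2) + A * (e / 2)); last by lra.
  by rewrite lerD ?hm// distrC hm.
have : (fun K => `|summability.partial_sum a K - \sum_(k <- J) a k|) @ totally
   --> `|summability.sum a - \sum_(k <- J) a k|.
  by apply: cvg_norm; apply: cvgB; [exact: cva|exact: cvg_cst].
by move/cvgr_to_le; apply.
Qed.

(* The box depends only on [e], so that tails are uniformly small over families
   of sequences with a common bound. *)
Lemma sumZ_approx (e : R) : 0 < e -> exists m, forall (a : Zn -> C) (A : R),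
  (forall k, cmod (a k) <= A * weight k) -> forall J : {fset Zn},
  (box m `<=` J)%fset ->
  cmod (sumZ a - \sum_(k <- J) a k) <= A * e.
Proof.
move=> e0; have e20 : 0 < e / 2 by rewrite divr_gt0.
have [m hm] := rsum_approx e20; exists m => a A aA J mJ.
rewrite (le_trans (cmod_leD _))// Re_add Im_add Re_opp Im_opp Re_sum Im_sum.
rewrite [A * e](_ : _ = A * (e / 2) + A * (e / 2)); last by lra.
by rewrite lerD//= hm// => k; rewrite (le_trans _ (aA k))/= ?cmod_Re ?cmod_Im.
Qed.

Lemma abs_summable_weight (a : Zn -> C) (A : R) :
  (forall k, cmod (a k) <= A * weight k) -> abs_summable a.
Proof.
move=> aA; rewrite /abs_summable /esum.summable.
apply: (@le_lt_trans _ _ (A * 5 ^+ n)%:E); last exact: ltry.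
have A0 : 0 <= A.
  have := le_trans (cmod_ge0 _) (aA 0); rewrite pmulr_lge0//.
  exact: weight_gt0.
apply: ge_ereal_sup => _ [F [finF _] <-].
rewrite fsbig_finite//= sumEFin lee_fin.
rewrite (@le_trans _ _ (\sum_(k <- fset_set F) A * weight k))//.
  apply: ler_sum => k _; rewrite ger0_norm ?cmod_ge0//.
by rewrite -mulr_sumr ler_wpM2l// sum_fset_weight.
Qed.

End lattice_sums.

(** * Partial derivatives *)

Section one_variable_bounds.
Context (R : realType).

Lemma mvt_abs (f df : R -> R) (t M : R) :
  (forall s : R, is_derive s 1 f (df s)) ->
  (forall s, `|s| <= `|t| -> `|df s| <= M) -> `|f t - f 0| <= M * `|t|.
Proof.
move=> fdf dfM.
have cf a b : {within `[a, b], continuous f}.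
  apply: continuous_subspaceT => s; apply: differentiable_continuous.
  by apply/derivable1_diffP; exact: ex_derive.
have [t0|t0] := leP 0 t.
  have [c] := MVT_segment t0 (fun x _ => fdf x) (cf 0 t).
  rewrite in_itv/= => /andP[c0 ct] ->; rewrite subr0 normrM ler_wpM2r// dfM//.
  by rewrite !ger0_norm.
have [c] := MVT_segment (ltW t0) (fun x _ => fdf x) (cf t 0).
rewrite in_itv/= => /andP[c0 ct] e.
rewrite distrC e sub0r normrM normrN ler_wpM2r// dfM//.
by rewrite !ler0_norm ?lerN2// ltW.
Qed.

(** The mean value bound is used twice, on [df] and then on f minus its tangent line at 0; this
    gives the constant M instead of the sharp M/2. *)
Lemma taylor2_abs (f df d2f : R -> R) (t M : R) :
  (forall s : R, is_derive s 1 f (df s)) -> (forall s : R, is_derive s 1 df (d2f s)) ->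
  (forall s, `|s| <= `|t| -> `|d2f s| <= M) ->
  `|f t - f 0 - t * df 0| <= M * t ^+ 2.
Proof.
move=> fdf dfd d2M.
pose g s := f s - s * df 0.
have gdg (s : R) : is_derive s 1 g (df s - df 0).
  by rewrite /g; apply: is_derive_eq; rewrite scaler0 add0r [_%:A]mulr1.
have -> : f t - f 0 - t * df 0 = g t - g 0.
  by rewrite /g mul0r subr0 addrAC.
rewrite -real_normK ?num_real// expr2 mulrA; apply: mvt_abs => // s st.
have h : `|df s - df 0| <= M * `|s|.
  by apply: mvt_abs => // r rs; rewrite d2M// (le_trans rs).
by rewrite (le_trans h)// ler_wpM2l// (le_trans _ (d2M 0 _))// normr0.
Qed.

End one_variable_bounds.

Section partial_derivatives.
Context (R : realType) (n : nat).
Local Notation C := R[i].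
Local Notation Rn := 'rV[R]_n.
Implicit Types (f g : Rn -> C) (i : 'I_n) (x : Rn).
Local Notation e_ i := (delta_mx 0 i : Rn).

Lemma is_derive_line (h : Rn -> R) (v x : Rn) (s : R) :
  (forall y, derivable h y v) ->
  is_derive s 1 (fun t => h (x + t *: v)) ('D_v h (x + s *: v)).
Proof.
move=> dh.
have e : (fun t : R => t^-1 *: (((fun t => h (x + t *: v)) \o shift s) (t *: 1)
     - h (x + s *: v))) =
    (fun t => t^-1 *: ((h \o shift (x + s *: v)) (t *: v) - h (x + s *: v))).
  apply/funext => t /=; congr (_ *: (h _ - _)).
  by rewrite -[t%:A]/(t * 1) mulr1 scalerDl addrCA.
by split; rewrite /derivable /derive e//; exact: dh.
Qed.

(** The function [partial] has a value even where the derivative fails to exist; this relation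
    records existence together with the value. *)
Definition has_partial i x f (l : C) :=
  is_derive x (e_ i) (@complex.Re R \o f) (complex.Re l) /\
  is_derive x (e_ i) (@complex.Im R \o f) (complex.Im l).

Lemma has_partialE i x f l : has_partial i x f l -> partial i f x = l.
Proof.
by move=> [h1 h2]; rewrite /partial !derive_val; case: l {h1 h2}.
Qed.

Definition ccontinuous f :=
  continuous (@complex.Re R \o f) /\ continuous (@complex.Im R \o f).

(** A coinduction principle: membership in P passes to every iterated derivative, so it is enough to
    exhibit one derivative in each direction that stays in P. *)
Lemma smooth_coind (P : set (Rn -> C)) :
  (forall f, P f -> ccontinuous f /\
     forall i, exists2 g, P g & forall x, has_partial i x f (g x)) ->
  P `<=` @smooth R n.
Proof.
move=> hP f Pf s.
have Ps : P (partials s f).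
  elim: s => [//|i s IH] /=; have [_ /(_ i)[g Pg fg]] := hP _ IH.
  by rewrite (_ : partial i _ = g)//; apply/funext => x; exact: has_partialE.
have [[c1 c2] d] := hP _ Ps.
by split; split => // i x; have [g _ /(_ x)[[h1 _] [h2 _]]] := d i.
Qed.

Lemma partials_rcons s i f : partials (rcons s i) f = partials s (partial i f).
Proof. by rewrite /partials foldr_rcons. Qed.

Lemma smooth_partial i f : smooth f -> smooth (partial i f).
Proof. by move=> sf s; rewrite -partials_rcons; exact: sf. Qed.

Lemma smooth_continuous f : smooth f -> ccontinuous f.
Proof. by move=> /(_ [::])[[? _] [? _]]. Qed.

Lemma smooth_has_partial f i x : smooth f -> has_partial i x f (partial i f x).
Proof.
by move=> /(_ [::])[[_ d1] [_ d2]]; split; apply/derivableP.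
Qed.

Lemma schwartz_smooth f : schwartz f -> smooth f. Proof. by case. Qed.

Lemma schwartz_partial i f : schwartz f -> schwartz (partial i f).
Proof.
move=> [sf hf]; split; first exact: smooth_partial.
by move=> a s; rewrite -partials_rcons; exact: hf.
Qed.

Lemma cmod_ge_parts (z : C) (a b : R) : `|complex.Re z| <= a ->
  `|complex.Im z| <= b -> cmod z <= a + b.
Proof. by move=> h1 h2; rewrite (le_trans (cmod_leD z))// lerD. Qed.

(** Taylor along the line through x in direction i, for the real and the imaginary part separately;
    adding the two bounds produces the factor 2. *)
Lemma smooth_taylor2 f i x (t M : R) : smooth f ->
  (forall s, `|s| <= `|t| ->
     cmod (partial i (partial i f) (x + s *: e_ i)) <= M) ->
  cmod (f (x + t *: e_ i) - f x - t%:C * partial i f x) <= 2 * M * t ^+ 2.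
Proof.
move=> sf hM; have [[_ d1] [_ d2]] := sf [::].
have [[_ d1'] [_ d2']] := sf [:: i].
rewrite -mulrA (mulr_natl _ 2) mulr2n.
(* [p] stands for either the real or the imaginary part. *)
have h (p : C -> R) (ph : forall z, `|p z| <= cmod z)
    (pB : forall z w, p (z - w) = p z - p w)
    (pR : forall (r : R) z, p (r%:C * z) = r * p z)
    (dp : forall y, derivable (p \o f) y (e_ i))
    (dp' : forall y, derivable (p \o partial i f) y (e_ i)) :
    (forall g y, 'D_(e_ i) (p \o g) y = p (partial i g y)) ->
    `|p (f (x + t *: e_ i) - f x - t%:C * partial i f x)| <= M * t ^+ 2.
  move=> Dp; have Dpf : 'D_(e_ i) (p \o f) = p \o partial i f.
    by apply/funext => y; rewrite Dp.
  have hf (s : R) : is_derive s 1 (fun t => (p \o f) (x + t *: e_ i))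
      ((p \o partial i f) (x + s *: e_ i)).
    by rewrite /= -Dp; exact: is_derive_line.
  have hf' s := is_derive_line x s dp'.
  have /= := taylor2_abs hf hf'.
  rewrite scale0r addr0 !pB pR; apply => s st.
  by rewrite Dp (le_trans _ (hM _ st)).
apply: cmod_ge_parts.
  apply: (h (@complex.Re R)) => //; first exact: cmod_Re.
    by move=> z w; rewrite Re_add Re_opp.
  by move=> r z; rewrite Re_mul/= mul0r subr0.
apply: (h (@complex.Im R)) => //; first exact: cmod_Im.
  by move=> z w; rewrite Im_add Im_opp.
by move=> r z; rewrite Im_mul/= mul0r addr0.
Qed.

(** A converse to Taylor's formula. Unlike difference quotients in the limit, quadratic remainder
    bounds can be summed over the lattice, which is how a series gets differentiated. *)
Lemma is_derive_quadratic (h : Rn -> R) (v x : Rn) (l A : R) :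
  (forall t, `|t| <= 1 -> `|h (x + t *: v) - h x - t * l| <= A * t ^+ 2) ->
  is_derive x v h l.
Proof.
move=> hA.
have A0 : 0 <= A.
  have := hA 1; rewrite normr1 lexx expr1n mulr1 => /(_ erefl).
  exact: le_trans.
suff : (fun t => t^-1 *: ((h \o shift x) (t *: v) - h x)) @ 0^' --> l.
  by move=> hc; split; [apply/cvg_ex; exists l|exact/cvg_lim].
apply/cvgrPdist_le => /= e e0; near=> t.
have t0 : t != 0 by near: t; exact: nbhs_dnbhs_neq.
have t1 : `|t| <= 1.
  by near: t; apply: dnbhs0_le.
rewrite distrC (_ : _ - l = t^-1 * (h (x + t *: v) - h x - t * l)); last first.
  by rewrite [RHS]mulrBr mulKf// [x + _]addrC.
rewrite normrM normrV ?unitfE//.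
rewrite (@le_trans _ _ (`|t|^-1 * (A * t ^+ 2)))//.
  by rewrite ler_wpM2l// hA.
rewrite -real_normK ?num_real// expr2 mulrCA mulKf ?normr_eq0//.
rewrite (@le_trans _ _ ((A + 1) * `|t|))// ?ler_wpM2r ?lerDl//.
rewrite mulrC -ler_pdivlMr ?ltr_wpDl//.
by near: t; apply: dnbhs0_le; rewrite divr_gt0// ltr_wpDl.
Unshelve. all: by end_near. Qed.

Lemma has_partial_quadratic f i x l (A : R) :
  (forall t, `|t| <= 1 ->
    cmod (f (x + t *: e_ i) - f x - t%:C * l) <= A * t ^+ 2) ->
  has_partial i x f l.
Proof.
move=> hA; split; apply: (@is_derive_quadratic _ _ _ _ A) => t t1.
  rewrite (le_trans _ (hA t t1))//= (le_trans _ (cmod_Re _))//.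
  by rewrite !Re_add !Re_opp Re_mul/= mul0r subr0.
rewrite (le_trans _ (hA t t1))//= (le_trans _ (cmod_Im _))//.
by rewrite !Im_add !Im_opp Im_mul/= mul0r addr0.
Qed.

Lemma has_partialD f g i x l l' : has_partial i x f l -> has_partial i x g l' ->
  has_partial i x (fun y => f y + g y) (l + l').
Proof.
move=> [f1 f2] [g1 g2]; split.
  rewrite (_ : _ \o _ = (@complex.Re R \o f) + (@complex.Re R \o g)); last first.
    by apply/funext => y /=; rewrite Re_add.
  by apply: is_derive_eq; rewrite Re_add.
rewrite (_ : _ \o _ = (@complex.Im R \o f) + (@complex.Im R \o g)); last first.
  by apply/funext => y /=; rewrite Im_add.
by apply: is_derive_eq; rewrite Im_add.
Qed.

Lemma has_partialM f g i x l l' : has_partial i x f l -> has_partial i x g l' ->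
  has_partial i x (fun y => f y * g y) (l * g x + f x * l').
Proof.
move=> [f1 f2] [g1 g2]; split.
  rewrite (_ : _ \o _ = (@complex.Re R \o f) * (@complex.Re R \o g) -
      (@complex.Im R \o f) * (@complex.Im R \o g)); last first.
    by apply/funext => y /=; rewrite Re_mul.
  by apply: is_derive_eq; rewrite /= Re_add !Re_mul /GRing.scale/=; ring.
rewrite (_ : _ \o _ = (@complex.Re R \o f) * (@complex.Im R \o g) +
    (@complex.Im R \o f) * (@complex.Re R \o g)); last first.
  by apply/funext => y /=; rewrite Im_mul.
by apply: is_derive_eq; rewrite /= Im_add !Im_mul /GRing.scale/=; ring.
Qed.

Lemma ccontinuousD f g : ccontinuous f -> ccontinuous g ->
  ccontinuous (fun y => f y + g y).
Proof.
move=> [f1 f2] [g1 g2]; split => x.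
  rewrite (_ : _ \o _ = (@complex.Re R \o f) \+ (@complex.Re R \o g)); last first.
    by apply/funext => y /=; rewrite Re_add.
  by apply: continuousD; [exact: f1|exact: g1].
rewrite (_ : _ \o _ = (@complex.Im R \o f) \+ (@complex.Im R \o g)); last first.
  by apply/funext => y /=; rewrite Im_add.
by apply: continuousD; [exact: f2|exact: g2].
Qed.

Lemma ccontinuousM f g : ccontinuous f -> ccontinuous g ->
  ccontinuous (fun y => f y * g y).
Proof.
move=> [f1 f2] [g1 g2]; split => x.
  rewrite (_ : _ \o _ = ((@complex.Re R \o f) \* (@complex.Re R \o g)) \-
      ((@complex.Im R \o f) \* (@complex.Im R \o g))); last first.
    by apply/funext => y /=; rewrite Re_mul.
  apply: continuousB; apply: continuousM;
    [exact: f1|exact: g1|exact: f2|exact: g2].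
rewrite (_ : _ \o _ = ((@complex.Re R \o f) \* (@complex.Im R \o g)) \+
    ((@complex.Im R \o f) \* (@complex.Re R \o g))); last first.
  by apply/funext => y /=; rewrite Im_mul.
apply: continuousD; apply: continuousM;
  [exact: f1|exact: g2|exact: f2|exact: g1].
Qed.

Lemma ccontinuous_cst (c : C) : ccontinuous (fun=> c).
Proof. by split => x; exact: cst_continuous. Qed.

Lemma ccontinuous_sum (I : Type) (r : seq I) (F : I -> Rn -> C) :
  (forall k, ccontinuous (F k)) -> ccontinuous (fun y => \sum_(k <- r) F k y).
Proof.
move=> cF; elim: r => [|k r IH].
  rewrite (_ : (fun y => _) = fun=> 0); first exact: ccontinuous_cst.
  by apply/funext => y; rewrite big_nil.
rewrite (_ : (fun y => _) = fun y => F k y + \sum_(k <- r) F k y).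
  exact: ccontinuousD.
by apply/funext => y; rewrite big_cons.
Qed.

Lemma continuous_uapprox (h : Rn -> R) (x : Rn) :
  (forall e, 0 < e -> exists2 g : Rn -> R, continuous g &
    \forall y \near x, `|h y - g y| <= e) -> {for x, continuous h}.
Proof.
move=> H; apply/(@cvgrPdist_le _ _ _ _ (nbhs_filter x)) => /= e e0.
have e3 : 0 < e / 3 by rewrite divr_gt0.
have [g cg hg] := H _ e3.
have := cg x; move/(@cvgrPdist_le _ _ _ _ (nbhs_filter x)) => /(_ _ e3) cgx.
have hx : `|h x - g x| <= e / 3 by exact: nbhs_singleton hg.
near=> y.
have h1 : `|h y - g y| <= e / 3 by near: y.
have h2 : `|g x - g y| <= e / 3 by near: y; exact: cgx.
have -> : h x - h y = (h x - g x) + ((g x - g y) - (h y - g y)) by ring.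
have -> : e = e / 3 + (e / 3 + e / 3) by field.
rewrite (le_trans (ler_normD _ _))// lerD// (le_trans (ler_normB _ _))//.
by rewrite lerD.
Unshelve. all: by end_near. Qed.

(** Locally uniform approximation suffices: the approximant may depend on the point as well as on
    e. *)
Lemma ccontinuous_uapprox f :
  (forall x e, 0 < e -> exists2 g, ccontinuous g &
    \forall y \near x, cmod (f y - g y) <= e) -> ccontinuous f.
Proof.
move=> H; split => x; apply: continuous_uapprox => e e0;
    have [g [g1 g2] fg] := H x _ e0.
  exists (@complex.Re R \o g) => //; apply: filterS fg => y h /=.
  by rewrite (le_trans _ h)// (le_trans _ (cmod_Re _))// Re_add Re_opp.
exists (@complex.Im R \o g) => //; apply: filterS fg => y h /=.
by rewrite (le_trans _ h)// (le_trans _ (cmod_Im _))// Im_add Im_opp.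
Qed.

Lemma near_coords (x : Rn) (d : R) : 0 < d ->
  \forall y \near x, forall i, `|(y : Rn) 0 i - x 0 i| <= d.
Proof.
move=> d0; apply: (@filter_forall _ _ _ _ (nbhs_filter x)) => i.
have := @coord_continuous R 1 n 0 i x.
move/(@cvgrPdist_le _ _ _ _ (nbhs_filter x)) => /(_ _ d0).
by apply: filterS => y; rewrite distrC.
Qed.

Lemma ccontinuous_shift f (v : Rn) : ccontinuous f ->
  ccontinuous (fun y => f (y + v)).
Proof.
have c : continuous (fun y : Rn => y + v).
  move=> x; apply: (@continuousD _ _ _ id (cst v)); first exact: cvg_id.
  exact: cst_continuous.
move=> [f1 f2]; split => x.
  exact: (continuous_comp (c x) (f1 _)).
exact: (continuous_comp (c x) (f2 _)).
Qed.

End partial_derivatives.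

(** * Smoothness of the periodization *)

Section weighted_sums.
Context (R : realType) (n : nat).
Local Notation C := R[i].
Local Notation Zn := 'rV[int]_n.
Implicit Types a b : Zn -> C.

Definition wbounded a := exists A : R, forall k, cmod (a k) <= A * weight R k.

Lemma weight_bound_ge0 (c : Zn -> R) (A : R) :
  (forall k, 0 <= c k <= A * weight R k) -> 0 <= A.
Proof.
move=> h; have /andP[h1 h2] := h 0.
by have := le_trans h1 h2; rewrite pmulr_lge0// weight_gt0.
Qed.

Lemma wbounded_ge0 a : wbounded a ->
  exists2 A : R, 0 <= A & forall k, cmod (a k) <= A * weight R k.
Proof.
move=> [A hA]; exists A => //; apply: (@weight_bound_ge0 (fun k => cmod (a k))).
by move=> k; rewrite cmod_ge0 hA.
Qed.

Lemma sumZ_near a : wbounded a -> forall e : R, 0 < e -> exists m,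
  forall J : {fset Zn}, (box n m `<=` J)%fset ->
  cmod (sumZ a - \sum_(k <- J) a k) <= e.
Proof.
move=> /wbounded_ge0[A A0 hA] e e0.
have e' : 0 < e / (A + 1) by rewrite divr_gt0// ltr_wpDl.
have [m hm] := @sumZ_approx R n _ e'; exists m => J mJ.
rewrite (le_trans (hm _ _ hA _ mJ))//.
by rewrite mulrCA ger_pMr// ler_pdivrMr ?mul1r ?lerDl// ltr_wpDl.
Qed.

(** For dominated sequences the limit along the boxes alone identifies the unordered sum, so
    explicit formulas for box sums can be used. *)
Lemma sumZ_unique a (l : C) : wbounded a ->
  (forall e : R, 0 < e -> exists m, forall m', (m <= m')%N ->
    cmod (l - \sum_(k <- box n m') a k) <= e) -> sumZ a = l.
Proof.
move=> wa hl; apply: eq_cmod_small => e e0.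
have e2 : 0 < e / 2 by rewrite divr_gt0.
have [m hm] := sumZ_near wa e2; have [m' hm'] := hl _ e2.
rewrite (le_trans (cmod_dist_triangle _ (\sum_(k <- box n (maxn m m')) a k) _))//.
rewrite [leRHS](_ : _ = e / 2 + e / 2); last by field.
rewrite lerD// ?hm ?box_subset ?leq_maxl// cmodBC hm'//.
exact: leq_maxr.
Qed.

Lemma cmod_sumZ_le a (A : R) : (forall k, cmod (a k) <= A * weight R k) ->
  cmod (sumZ a) <= A * 5 ^+ n.
Proof.
move=> hA; have A0 : 0 <= A.
  apply: (@weight_bound_ge0 (fun k => cmod (a k))) => k.
  by rewrite cmod_ge0 hA.
apply/ler_addgt0Pl => e e0.
have wa : wbounded a by exists A.
have [m hm] := sumZ_near wa e0.
rewrite (_ : sumZ a = (sumZ a - \sum_(k <- box n m) a k) +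
  \sum_(k <- box n m) a k); last by rewrite subrK.
rewrite (le_trans (cmodD _ _))// lerD ?hm// (le_trans (cmod_sum _ _ _))//.
rewrite (le_trans (ler_sum _ (fun k _ => hA k)))// -mulr_sumr.
by rewrite ler_wpM2l// sum_box_weight.
Qed.

Lemma wboundedD a b : wbounded a -> wbounded b -> wbounded (fun k => a k + b k).
Proof.
move=> [A hA] [B hB]; exists (A + B) => k.
by rewrite (le_trans (cmodD _ _))// mulrDl lerD.
Qed.

Lemma wboundedZ (c : C) a : wbounded a -> wbounded (fun k => c * a k).
Proof.
move=> [A hA]; exists (cmod c * A) => k.
by rewrite cmodM -mulrA ler_wpM2l// cmod_ge0.
Qed.

Lemma sumZD a b : wbounded a -> wbounded b ->
  sumZ (fun k => a k + b k) = sumZ a + sumZ b.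
Proof.
move=> wa wb; apply: sumZ_unique; first exact: wboundedD.
move=> e e0; have e2 : 0 < e / 2 by rewrite divr_gt0.
have [m hm] := sumZ_near wa e2; have [m' hm'] := sumZ_near wb e2.
exists (maxn m m') => M; rewrite geq_max => /andP[mM m'M].
rewrite big_split/= opprD addrACA (le_trans (cmodD _ _))//.
rewrite [leRHS](_ : _ = e / 2 + e / 2); last by field.
by rewrite lerD// ?hm ?hm' ?box_subset.
Qed.

Lemma sumZZ (c : C) a : wbounded a -> sumZ (fun k => c * a k) = c * sumZ a.
Proof.
move=> wa; apply: sumZ_unique; first exact: wboundedZ.
move=> e e0; have c1 : 0 < cmod c + 1 by rewrite ltr_wpDl// cmod_ge0.
have e2 : 0 < e / (cmod c + 1) by rewrite divr_gt0.
have [m hm] := sumZ_near wa e2; exists m => M mM.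
rewrite -mulr_sumr -mulrBr cmodM.
rewrite (le_trans (ler_wpM2l (cmod_ge0 _) (hm _ _)))// ?box_subset//.
by rewrite mulrCA ger_pMr// ler_pdivrMr ?mul1r ?lerDl.
Qed.

Lemma sumZB a b : wbounded a -> wbounded b ->
  sumZ (fun k => a k - b k) = sumZ a - sumZ b.
Proof.
move=> wa wb; have := sumZD wa (wboundedZ (-1) wb).
rewrite sumZZ// mulN1r => <-; congr sumZ.
by apply/funext => k; rewrite mulN1r.
Qed.

Lemma sumZ_shift a (l : Zn) : wbounded a -> wbounded (fun k => a (k + l)) ->
  sumZ (fun k => a (k + l)) = sumZ a.
Proof.
move=> wa wal; apply: eq_cmod_small => e e0.
have e2 : 0 < e / 2 by rewrite divr_gt0.
have [m hm] := sumZ_near wa e2; have [m' hm'] := sumZ_near wal e2.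
(* [J] contains one box, and its translate by [l] contains the other, so a single finite sum
   approximates both sides. *)
pose J := (box n m' `|` [fset (k - l)%R | k in box n m])%fset.
rewrite (le_trans (cmod_dist_triangle _ (\sum_(k <- J) a (k + l)) _))//.
rewrite [leRHS](_ : _ = e / 2 + e / 2); last by field.
rewrite lerD ?hm' ?fsubsetUl//.
have <- : \sum_(k <- [fset (k + l)%R | k in J]%fset) a k = \sum_(k <- J) a (k + l).
  by rewrite big_imfset//= => x y _ _; exact: addIr.
rewrite cmodBC hm//; apply/fsubsetP => k km; apply/imfsetP.
exists (k - l); rewrite /= ?subrK// /J inE; apply/orP; right.
by apply/imfsetP; exists k.
Qed.

End weighted_sums.

(** * Domination of the translates and differentiation term by term *)

Section periodization_smooth.
Context (R : realType) (n : nat).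
Local Notation C := R[i].
Local Notation Rn := 'rV[R]_n.
Local Notation Zn := 'rV[int]_n.
Implicit Types (f g : Rn -> C) (i : 'I_n) (x y : Rn) (k l : Zn).
Local Notation e_ i := (delta_mx 0 i : Rn).

Lemma ZnRE k i : ZnR R k 0 i = (k 0 i)%:~R.
Proof. by rewrite mxE. Qed.

Lemma ZnRD k l : ZnR R (k + l) = ZnR R k + ZnR R l.
Proof. by apply/rowP => i; rewrite !mxE intrD. Qed.

Lemma ZnR0 : ZnR R (0 : Zn) = 0.
Proof. by apply/rowP => i; rewrite !mxE. Qed.

Lemma ZnRN k : ZnR R (- k) = - ZnR R k.
Proof. by apply/rowP => i; rewrite !mxE mulrNz. Qed.

Lemma pi_ge1 : 1 <= pi :> R.
Proof. by rewrite (le_trans _ (pi_ge2 R))// ler1n. Qed.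

(** Expanding the product of the [1 + x 0 i ^+ 2] over subsets J, where J collects the coordinates
    contributing 1, gives finitely many monomials, each controlled by one Schwartz seminorm. *)
Lemma schwartz_decay f : schwartz f -> exists2 A : R, 0 <= A &
  forall x, cmod (f x) <= A * \prod_i (1 + x 0 i ^+ 2)^-1.
Proof.
move=> [_ hf].
have /choice[M hM] : forall J : {set 'I_n}, exists M : R, forall x,
    `|monomial (fun i => if i \in J then 0%N else 2%N) x| * cmod (f x) <= M.
  by move=> J; have [M hM] := hf (fun i => if i \in J then 0%N else 2%N) [::];
    exists M.
have key x : \prod_i (1 + x 0 i ^+ 2) * cmod (f x) <= \sum_J M J.
  rewrite bigA_distr mulr_suml; apply: ler_sum => J _.
  rewrite (le_trans _ (hM J x))// ler_wpM2r ?cmod_ge0// (le_trans _ (ler_norm _))//.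
  rewrite /monomial le_eqVlt; apply/orP; left; apply/eqP.
  by apply: eq_bigr => i _; case: ifP.
have p0 x : 0 < \prod_i (1 + x 0 i ^+ 2).
  by apply: prodr_gt0 => i _; rewrite ltr_pwDl// sqr_ge0.
exists (\sum_J M J).
  by rewrite (le_trans _ (key 0))// mulr_ge0 ?cmod_ge0// ltW.
by move=> x; rewrite prodfV ler_pdivlMr// mulrC.
Qed.

(** The 6 comes from 1 + z^2 <= 6 (1 + a^2)(1 + c^2), where a is a coordinate of x, z one of k, and
    c = b + 2 pi z with b within 1 of a. *)
Definition growth x : R := \prod_i (6 * (1 + x 0 i ^+ 2)).

Lemma growth_ge0 x : 0 <= growth x.
Proof. by apply: prodr_ge0 => i _; rewrite mulr_ge0// addr_ge0// sqr_ge0. Qed.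

(** An inequality of Peetre type: z is controlled by c and b, and b by a, through (u + v)^2 <= 2 u^2
    + 2 v^2. The constant depends on x but not on the nearby point y, whence the locally uniform
    domination. *)
Lemma peetre_weight x y k : (forall i, `|y 0 i - x 0 i| <= 1) ->
  \prod_i (1 + (y + (2 * pi) *: ZnR R k) 0 i ^+ 2)^-1 <=
  growth x * weight R k.
Proof.
move=> yx; rewrite /growth /weight -big_split/=; apply: ler_prod => i _.
rewrite invr_ge0 addr_ge0 ?sqr_ge0//= 3!mxE.
have := yx i; move: (x 0 i) (y 0 i) ((k 0 i)%:~R : R) => a b z ab.
have zz (u : R) : 0 < 1 + u ^+ 2 by rewrite ltr_pwDl// sqr_ge0.
rewrite ler_pdivlMr// mulrC ler_pdivrMr// mulrC.
have h1 : b ^+ 2 <= 2 * a ^+ 2 + 2.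
  have : (b - a) ^+ 2 <= 1 by rewrite -real_normK ?num_real// expr_le1.
  have := sqr_ge0 (b - 2 * a); nra.
set c := b + 2 * pi * z.
have h2 : z ^+ 2 <= 2 * c ^+ 2 + 2 * b ^+ 2.
  have : z ^+ 2 <= (2 * pi * z) ^+ 2.
    by rewrite exprMn ler_peMl ?sqr_ge0//; have := pi_ge1; nra.
  have -> : 2 * pi * z = c - b by rewrite /c addrC addKr.
  have := sqr_ge0 (c + b); nra.
have := sqr_ge0 a; have := sqr_ge0 c; have := mulr_ge0 (sqr_ge0 a) (sqr_ge0 c).
nra.
Qed.

Lemma schwartz_shift_bound f : schwartz f -> exists2 A : R, 0 <= A &
  forall x y k, (forall i, `|y 0 i - x 0 i| <= 1) ->
    cmod (f (y + (2 * pi) *: ZnR R k)) <= A * growth x * weight R k.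
Proof.
move=> /schwartz_decay[A A0 hA]; exists A => // x y k xy.
by rewrite (le_trans (hA _))// -mulrA ler_wpM2l// peetre_weight.
Qed.

Lemma schwartz_wbounded f x : schwartz f ->
  wbounded (fun k => f (x + (2 * pi) *: ZnR R k)).
Proof.
move=> /schwartz_shift_bound[A A0 hA]; exists (A * growth x) => k.
by apply: hA => i; rewrite subrr normr0.
Qed.

Lemma periodization_periodic f x l : schwartz f ->
  periodization f (x + (2 * pi) *: ZnR R l) = periodization f x.
Proof.
move=> sf; rewrite /periodization.
rewrite -(@sumZ_shift _ _ (fun k => f (x + (2 * pi) *: ZnR R k)) l);
  last 2 first.
- exact: schwartz_wbounded.
- rewrite (_ : (fun k => _) =
    fun k => f ((x + (2 * pi) *: ZnR R l) + (2 * pi) *: ZnR R k)).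
    exact: schwartz_wbounded.
  by apply/funext => k; rewrite ZnRD scalerDr addrCA addrC -addrA addrC.
congr sumZ; apply/funext => k.
by rewrite ZnRD scalerDr -addrA [X in f (_ + X)]addrC.
Qed.

Lemma coord_line x i (t : R) j : `|t| <= 1 ->
  `|(x + t *: e_ i) 0 j - x 0 j| <= 1.
Proof.
move=> t1; rewrite !mxE /= addrAC subrr add0r normrM.
by case: (j == i); rewrite ?normr1 ?normr0 ?mulr1 ?mulr0.
Qed.

Lemma periodization_continuous f : schwartz f -> ccontinuous (periodization f).
Proof.
move=> sf; have [A A0 hA] := schwartz_shift_bound sf.
apply: ccontinuous_uapprox => x e e0.
have B0 : 0 < A * growth x + 1 by rewrite ltr_wpDl// mulr_ge0// growth_ge0.
have e1 : 0 < e / (A * growth x + 1) by rewrite divr_gt0.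
have [m hm] := @sumZ_approx R n _ e1.
exists (fun y => \sum_(k <- box n m) f (y + (2 * pi) *: ZnR R k)).
  apply: ccontinuous_sum => k; apply: ccontinuous_shift.
  exact/smooth_continuous/schwartz_smooth.
have := near_coords x (@ltr01 R); apply: filterS => y xy.
rewrite (le_trans (hm _ (A * growth x) _ _ _))//; first by move=> k; exact: hA.
by rewrite mulrCA ger_pMr// ler_pdivrMr ?mul1r ?lerDl.
Qed.

Lemma periodization_has_partial f i x : schwartz f ->
  has_partial i x (periodization f) (periodization (partial i f) x).
Proof.
move=> sf; have sf1 := schwartz_partial i sf; have sf2 := schwartz_partial i sf1.
have [A A0 hA] := schwartz_shift_bound sf2.
(* Each translate leaves a Taylor remainder [2 * (A * growth x * weight R k) * t ^+ 2]; summing the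
   weights brings in [5 ^+ n]. *)
apply: (@has_partial_quadratic _ _ _ _ _ _ (2 * (A * growth x) * 5 ^+ n)) => t t1.
rewrite /periodization -sumZZ; last exact: schwartz_wbounded.
rewrite -sumZB; [|exact: schwartz_wbounded..].
rewrite -sumZB; last 2 first.
- have := wboundedD (schwartz_wbounded (x + t *: e_ i) sf)
    (wboundedZ (-1) (schwartz_wbounded x sf)).
  by under eq_fun do rewrite mulN1r.
- by apply: wboundedZ; exact: schwartz_wbounded.
rewrite mulrAC; apply: cmod_sumZ_le => k.
have -> : x + t *: e_ i + (2 * pi) *: ZnR R k =
  (x + (2 * pi) *: ZnR R k) + t *: e_ i by rewrite addrAC.
rewrite (_ : _ * weight R k = 2 * (A * growth x * weight R k) * t ^+ 2);
  last by ring.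
apply: smooth_taylor2.
  exact: schwartz_smooth.
move=> s st; rewrite addrAC; apply: hA => j.
by apply: coord_line; exact: le_trans st t1.
Qed.

Lemma periodization_smooth f : schwartz f -> smooth_torus (periodization f).
Proof.
move=> sf; split; last by move=> x k; exact: periodization_periodic.
(* The class of all periodizations is closed under partial derivation, because differentiation
   commutes with periodization. *)
apply: (@smooth_coind _ _ [set periodization g | g in @schwartz R n]); last by exists f.
move=> _ [g sg <-]; split; first exact: periodization_continuous.
move=> i; exists (periodization (partial i g)).
  by exists (partial i g) => //; exact: schwartz_partial.
by move=> x; exact: periodization_has_partial.
Qed.

End periodization_smooth.

(** * Surjectivity *)

Section sigmoid.
Context (R : realType).
Implicit Types (p : {poly R}) (x : R).

Definition sigmoid x : R := (1 + expR (- x))^-1.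

Let den_gt0 x : 0 < 1 + expR (- x).
Proof. by rewrite ltr_wpDr ?expR_ge0. Qed.

Lemma sigmoid_ge0 x : 0 <= sigmoid x.
Proof. by rewrite invr_ge0 ltW. Qed.

Lemma sigmoid_le1 x : sigmoid x <= 1.
Proof. by rewrite invf_le1// lerDl expR_ge0. Qed.

Lemma sigmoid_le_expR x : sigmoid x <= expR x.
Proof.
rewrite -[leRHS]invrK -expRN lef_pV2 ?posrE ?expR_gt0//.
by rewrite lerDr.
Qed.

Lemma sigmoidN x : 1 - sigmoid x = sigmoid (- x).
Proof.
rewrite /sigmoid opprK expRN; have e0 := expR_gt0 x.
by field; do ?[apply/andP; split]; apply: lt0r_neq0; rewrite ?addr_gt0// addrC.
Qed.

Lemma sigmoid_nondecreasing x y : x <= y -> sigmoid x <= sigmoid y.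
Proof. by move=> xy; rewrite lef_pV2 ?posrE// lerD2l ler_expR lerN2. Qed.

Lemma is_derive_sigmoid x :
  is_derive x 1 sigmoid (sigmoid x * (1 - sigmoid x)).
Proof.
have d0 := lt0r_neq0 (den_gt0 x).
have h : is_derive x 1 (fun y : R => 1 + expR (- y)) (- expR (- x)).
  have he : is_derive x 1 (expR \o -%R) (expR (- x) * -1).
    exact: is_derive1_comp.
  apply: (@is_derive_eq _ _ _ ((cst 1 : R -> R) + (expR \o -%R))).
  by rewrite add0r mulrN1.
have := @is_deriveV R (fun y : R => 1 + expR (- y)) x _ 1 d0 h; rewrite -/sigmoid => h'.
apply: (is_derive_eq h').
rewrite /sigmoid -exprVn /GRing.scale/=.
set e := expR (- x) in d0 *; field.
exact: d0.
Qed.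

Lemma is_derive_poly_sigmoid p x :
  is_derive x 1 (fun y => p.[sigmoid y]) (p^`() * 'X * (1 - 'X)).[sigmoid x].
Proof.
have := @is_derive1_comp R (horner p) sigmoid x _ _ (is_derive_poly p _)
  (is_derive_sigmoid x).
rewrite (_ : (_ * 'X * _).[_] = p^`().[sigmoid x] *
  (sigmoid x * (1 - sigmoid x)))//.
by rewrite 2!hornerM hornerX hornerD hornerN hornerX hornerC mulrA.
Qed.

(** The polynomial is a parameter so that the family is stable under differentiation; the
    telescoping function is the case p = ['X]. *)
Definition bump p x : R := p.[sigmoid x] - p.[sigmoid (x - 2 * pi)].

(* The derivative of the sigmoid s is s (1 - s): all the derivatives of a bump
   are bumps. *)
Lemma is_derive_bump p x :
  is_derive x 1 (bump p) (bump (p^`() * 'X * (1 - 'X)) x).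
Proof.
have h1 := is_derive_poly_sigmoid p x.
have h2 : is_derive x 1 (fun y => p.[sigmoid (y - 2 * pi)])
    (p^`() * 'X * (1 - 'X)).[sigmoid (x - 2 * pi)].
  have := @is_derive1_comp R (fun y => p.[sigmoid y]) (fun y => y - 2 * pi) x _ _
    (is_derive_poly_sigmoid p _).
  move=> /(_ 1); rewrite mulr1; apply.
  by apply: (@is_derive_eq _ _ _ (id - cst (2 * pi))); rewrite subr0.
exact: is_deriveB.
Qed.

(** Since the sigmoid takes values in [0, 1], this bounds every bump by a multiple of [bump 'X]. The
    sup bound is carried along because the Lipschitz bound for [p * 'X + c] uses it. *)
Lemma poly_lipschitz01 p : exists L : R, forall u v, 0 <= u <= 1 ->
  0 <= v <= 1 -> `|p.[u]| <= L /\ `|p.[u] - p.[v]| <= L * `|u - v|.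
Proof.
elim/poly_ind: p => [|p c [L hL]].
  by exists 0 => u v _ _; rewrite !horner0 subrr normr0 mul0r.
have L0 : 0 <= L.
  have [h _] := hL 0 0 ltac:(by rewrite lexx ler01) ltac:(by rewrite lexx ler01).
  exact: le_trans h.
exists (2 * L + `|c|) => u v u01 v01; have [h1 h2] := hL u v u01 v01.
have [h3 _] := hL v u v01 u01.
have [/andP[u0 u1] /andP[v0 v1]] := (u01, v01).
rewrite !hornerE; split.
  rewrite (le_trans (ler_normD _ _))// lerD2r normrM (ger0_norm u0).
  by rewrite (le_trans (ler_pM _ _ h1 u1))//; lra.
rewrite (_ : _ - _ = p.[u] * (u - v) + (p.[u] - p.[v]) * v); last by ring.
rewrite (le_trans (ler_normD _ _))// !normrM (ger0_norm v0) mulrDl.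
rewrite -[leLHS]addr0 lerD ?mulr_ge0// mulr_natl mulr2n mulrDl lerD//.
  by rewrite ler_wpM2r.
by rewrite (le_trans (ler_pM _ _ h2 v1))// mulr1.
Qed.

Lemma bumpX_ge0 x : 0 <= bump 'X x.
Proof.
rewrite /bump !hornerX subr_ge0 sigmoid_nondecreasing// gerBl.
by rewrite mulr_ge0// pi_ge0.
Qed.

(** For x >= 0 the bump is at most 1 - s(x - 2 pi) = s(2 pi - x), and for x < 0 at most s(x); both
    are then bounded by the exponential. *)
Lemma bumpX_decay x : bump 'X x <= expR (2 * pi) * expR (- `|x|).
Proof.
rewrite /bump !hornerX.
have p0 : 0 <= 2 * pi :> R by rewrite mulr_ge0 ?pi_ge0.
have e1 : 1 <= expR (2 * pi : R) by rewrite -[leLHS]expR0 ler_expR.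
have [x0|x0] := leP 0 x.
  rewrite ger0_norm// -expRD.
  rewrite (le_trans (lerB (sigmoid_le1 _) (lexx _)))// sigmoidN opprB.
  by rewrite (le_trans (sigmoid_le_expR _)).
rewrite ltr0_norm// opprK; have s0 := sigmoid_ge0 (x - 2 * pi).
rewrite (le_trans (_ : _ <= sigmoid x))// ?gerBl//.
by rewrite (le_trans (sigmoid_le_expR _))// ler_peMl ?expR_ge0.
Qed.

Lemma expr_expR_bounded (a : nat) x : 0 <= x -> x ^+ a * expR (- x) <= a`!%:R.
Proof.
move=> x0; rewrite expRN ler_pdivrMr ?expR_gt0//.
case: a => [|a]; first by rewrite expr0 mul1r -expR0 ler_expR.
have := expR_ge1Dxn a x0; set f := (a.+1)`!%:R : R.
have f0 : 0 < f by rewrite ltr0n fact_gt0.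
move=> h; rewrite mulrC -ler_pdivrMr// (le_trans _ h)// lerDr//.
Qed.

Lemma bump_decay p (a : nat) : exists2 M : R, 0 <= M &
  forall x, `|x| ^+ a * `|bump p x| <= M.
Proof.
have [L hL] := poly_lipschitz01 p.
have s01 y : 0 <= sigmoid y <= 1 by rewrite sigmoid_ge0 sigmoid_le1.
have L0 : 0 <= L.
  by have [h _] := hL _ _ (s01 0) (s01 0); exact: le_trans h.
exists (L * expR (2 * pi) * a`!%:R).
  by rewrite !mulr_ge0// expR_ge0.
move=> x; have [_ h] := hL _ _ (s01 x) (s01 (x - 2 * pi)).
have := bumpX_ge0 x; have := bumpX_decay x; rewrite {1 2}/bump !hornerX => h1 h0.
rewrite (ger0_norm h0) in h.
rewrite (le_trans (ler_wpM2l _ (le_trans h (ler_wpM2l L0 h1))))//.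
rewrite (_ : _ * (_ * _) = L * expR (2 * pi) * (`|x| ^+ a * expR (- `|x|)));
  last by ring.
by rewrite ler_wpM2l ?expr_expR_bounded// mulr_ge0// expR_ge0.
Qed.

Lemma sum_bump x m :
  \sum_(j < m.*2.+1) bump 'X (x + (2 * pi) * (j%:Z - m%:Z)%:~R) =
  1 - (sigmoid (- (x + 2 * pi * m%:R)) + sigmoid (x - 2 * pi * m.+1%:R)).
Proof.
(* Consecutive values of [u] are the two sigmoids of one bump. The ends are not symmetric: [u 0]
   sits at x - 2 pi (m + 1) and the last value at x + 2 pi m. *)
pose u (j : nat) := sigmoid (x + (2 * pi) * (j%:R - m%:R - 1)).
rewrite (eq_bigr (fun j : 'I_(m.*2.+1) => u j.+1 - u j)); last first.
  move=> j _; rewrite /bump !hornerX /u; congr (sigmoid _ - sigmoid _).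
    by rewrite intrB -!pmulrn -natr1; ring.
  by rewrite intrB -!pmulrn; ring.
rewrite -(big_mkord xpredT (fun j => u j.+1 - u j)) telescope_sumr// /u.
rewrite opprD addrA -sigmoidN opprB addrCA subrr addr0.
congr (sigmoid _ - sigmoid _); congr (_ + _).
  by congr (_ * _); rewrite -addnn -natr1 natrD; ring.
by rewrite -natr1; ring.
Qed.

End sigmoid.

(** * Coinduction for Schwartz functions; derivatives and bounds of periodic functions *)

Section smooth_torus_facts.
Context (R : realType) (n : nat).
Local Notation C := R[i].
Local Notation Rn := 'rV[R]_n.
Local Notation Zn := 'rV[int]_n.
Implicit Types (f g : Rn -> C) (i : 'I_n) (x y : Rn) (k l : Zn).
Local Notation e_ i := (delta_mx 0 i : Rn).

Lemma schwartz_coind (P : set (Rn -> C)) :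
  (forall f, P f -> [/\ ccontinuous f,
     forall i, exists2 g, P g & forall x, has_partial i x f (g x) &
     forall a : 'I_n -> nat, exists M : R,
       forall x, `|monomial a x| * cmod (f x) <= M]) ->
  P `<=` @schwartz R n.
Proof.
move=> hP f Pf; split.
  by apply: (smooth_coind _ Pf) => g /hP[].
move=> a s.
have Ps : P (partials s f).
  elim: s => [//|i s IH] /=; have [_ /(_ i)[g Pg fg] _] := hP _ IH.
  by rewrite (_ : partial i _ = g)//; apply/funext => x; exact: has_partialE.
by have [_ _] := hP _ Ps; exact.
Qed.

Lemma derive_periodic (h : Rn -> R) (v w x : Rn) :
  (forall y, h (y + w) = h y) -> 'D_v h (x + w) = 'D_v h x.
Proof.
move=> hw; rewrite /derive.
rewrite (_ : (fun t => _) = (fun t => t^-1 *: ((h \o shift x) (t *: v) - h x)))//.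
by apply/funext => t /=; rewrite addrA !hw.
Qed.

Lemma smooth_torus_partial i g : smooth_torus g -> smooth_torus (partial i g).
Proof.
move=> [sg pg]; split; first exact: smooth_partial.
move=> x k; rewrite /partial; congr (_ +i* _); apply: derive_periodic => y /=;
  by rewrite pg.
Qed.

(** The corner [a] is free: 0 gives the fundamental cube, and x0 - (pi, ..., pi) the cube centred at
    x0 used in the Korovkin estimate. *)
Lemma translate_to_cube (a x : Rn) : exists k, forall i,
  a 0 i <= (x - (2 * pi) *: ZnR R k) 0 i < a 0 i + 2 * pi.
Proof.
have p0 : 0 < 2 * pi :> R by rewrite mulr_gt0// pi_gt0.
exists (\row_i Num.floor ((x 0 i - a 0 i) / (2 * pi))) => i.
rewrite !mxE.
have /andP[h1 h2] := floor_itv ((x 0 i - a 0 i) / (2 * pi)).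
move: (Num.floor _) h1 h2 => j.
rewrite ler_pdivlMr// ltr_pdivrMr// intrD mulr1z => h1 h2.
by apply/andP; split; lra.
Qed.

Lemma periodic_bounded g : ccontinuous g ->
  (forall x k, g (x + (2 * pi) *: ZnR R k) = g x) ->
  exists2 M : R, 0 <= M & forall x, cmod (g x) <= M.
Proof.
move=> [g1 g2] pg.
pose K := [set v : Rn | forall i, `[0, 2 * pi]%classic (v ord0 i)].
have cK : compact K.
  by apply: (@rV_compact R n (fun=> `[0, 2 * pi]%classic)) => i; exact: segment_compact.
have bd (h : Rn -> R) : continuous h -> exists M, forall v, K v -> `|h v| <= M.
  move=> ch; have : compact (h @` K).
    by apply: continuous_compact => //; exact: continuous_subspaceT.
  move=> /compact_bounded[M [_ hM]].
  exists (M + 1) => v Kv; apply: (hM (M + 1)); first by rewrite ltrDl.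
  by exists v.
have [M1 h1] := bd _ g1; have [M2 h2] := bd _ g2.
have key x : cmod (g x) <= M1 + M2.
  have [k hk] := translate_to_cube 0 x.
  rewrite -(subrK ((2 * pi) *: ZnR R k) x) pg.
  have Kx : K (x - (2 * pi) *: ZnR R k).
    move=> i; have := hk i; rewrite [X in X <= _]mxE [X in X + 2 * pi]mxE add0r.
    by rewrite /= in_itv/= => /andP[-> /ltW ->].
  by rewrite (le_trans (cmod_leD _))// lerD ?(h1 _ Kx) ?(h2 _ Kx).
by exists (M1 + M2) => //; rewrite (le_trans _ (key 0))// cmod_ge0.
Qed.

Lemma smooth_torus_bounded g : smooth_torus g ->
  exists2 M : R, 0 <= M & forall x, cmod (g x) <= M.
Proof. by move=> [sg pg]; apply: periodic_bounded => //; exact: smooth_continuous. Qed.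

Lemma smooth_torus_cst (c : C) : smooth_torus (fun _ : Rn => c).
Proof.
split => //; apply: (@smooth_coind _ _ [set h | exists c, h = fun=> c]);
  last by exists c.
move=> _ [d ->]; split; first exact: ccontinuous_cst.
move=> i; exists (fun=> 0); first by exists 0.
move=> x; split; exact: is_derive_cst.
Qed.

End smooth_torus_facts.

(** * Products of bumps as a partition of unity *)

Section surjectivity.
Context (R : realType) (n : nat).
Local Notation C := R[i].
Local Notation Rn := 'rV[R]_n.
Local Notation Zn := 'rV[int]_n.
Implicit Types (f g : Rn -> C) (i : 'I_n) (x y : Rn) (k l : Zn).
Implicit Types (Q : 'I_n -> {poly R}).
Local Notation e_ i := (delta_mx 0 i : Rn).

Lemma is_derive_of_line (h : Rn -> R) (v x : Rn) (l : R) :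
  is_derive (0 : R) 1 (fun t : R => h (x + t *: v)) l -> is_derive x v h l.
Proof.
have e : (fun t : R => t^-1 *: (((fun t => h (x + t *: v)) \o shift 0) (t *: 1)
     - h (x + 0 *: v))) =
    (fun t => t^-1 *: ((h \o shift x) (t *: v) - h x)).
  apply/funext => t /=.
  by rewrite -[t%:A]/(t * 1) mulr1 addr0 scale0r addr0 [x + _]addrC.
by move=> [h1 h2]; split; [move: h1|move: h2]; rewrite /derivable /derive e.
Qed.

(** One polynomial per coordinate: differentiating in direction i alters [Q i] alone. *)
Definition cutoff Q x : R := \prod_i bump (Q i) (x 0 i).

Lemma cutoff_has_partial Q i x : has_partial i x (fun y => (cutoff Q y)%:C)
  (cutoff (fun j => if j == i then (Q i)^`() * 'X * (1 - 'X) else Q j) x)%:C.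
Proof.
split; last exact: is_derive_cst.
apply: is_derive_of_line => /=.
pose c := \prod_(j | j != i) bump (Q j) (x 0 j).
rewrite (_ : (fun t : R => cutoff Q (x + t *: e_ i)) =
    (fun t => c * bump (Q i) (x 0 i + t))); last first.
  apply/funext => t; rewrite /cutoff (bigD1 i)//= mulrC; congr (_ * _).
    apply: eq_bigr => j ji; rewrite !mxE (negbTE ji).
    by rewrite mulr0 addr0.
  by rewrite !mxE !eqxx mulr1.
rewrite /cutoff (bigD1 i)//= eqxx mulrC.
rewrite (eq_bigr (fun j => bump (Q j) (x 0 j))); last first.
  by move=> j /negbTE ->.
rewrite -/c.
have h : is_derive (0 : R) 1 (fun t : R => bump (Q i) (x 0 i + t))
    (bump ((Q i)^`() * 'X * (1 - 'X)) (x 0 i)).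
  have := @is_derive1_comp R (bump (Q i)) (fun t => x 0 i + t) 0
    (bump ((Q i)^`() * 'X * (1 - 'X)) (x 0 i)) 1.
  rewrite mulr1; apply.
    by have := is_derive_bump (Q i) (x 0 i); rewrite addr0.
  by apply: (@is_derive_eq _ _ _ (cst (x 0 i) + id)); rewrite add0r.
exact: (is_deriveZ c h).
Qed.

Lemma cutoff_continuous Q : ccontinuous (fun y => (cutoff Q y)%:C).
Proof.
split; last exact: cst_continuous.
rewrite (_ : _ \o _ = cutoff Q)//.
suff c (r : seq 'I_n) : continuous (fun y : Rn => \prod_(i <- r) bump (Q i) (y 0 i)).
  exact: c.
elim: r => [|i r IH] x.
  by under eq_fun do rewrite big_nil; exact: cst_continuous.
under eq_fun do rewrite big_cons.
apply: (@continuousM _ _ (fun y : Rn => bump (Q i) (y 0 i))); last exact: IH.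
apply: (@continuous_comp Rn R R (fun y => y 0 i) (bump (Q i))).
  exact: coord_continuous.
apply: differentiable_continuous; apply/derivable1_diffP.
by have [] := is_derive_bump (Q i) (x 0 i).
Qed.

Lemma cutoff_decay Q (a : 'I_n -> nat) : exists M : R,
  forall x, `|monomial a x| * `|cutoff Q x| <= M.
Proof.
have /choice[M hM] : forall i, exists M : R, 0 <= M /\
    forall x : R, `|x| ^+ a i * `|bump (Q i) x| <= M.
  by move=> i; have [M] := bump_decay (Q i) (a i); exists M.
exists (\prod_i M i) => x.
rewrite /monomial /cutoff !normr_prod -big_split/=; apply: ler_prod => i _.
by rewrite mulr_ge0// normrX (hM i).2.
Qed.

(** The class fed to the coinduction. Sums are included because the product rule turns a cutoff
    times a periodic function into two such terms. *)
Inductive cutoff_span : set (Rn -> C) :=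
| cutoff_mul Q g of smooth_torus g : cutoff_span (fun x => (cutoff Q x)%:C * g x)
| cutoff_add f g of cutoff_span f & cutoff_span g :
    cutoff_span (fun x => f x + g x).

Lemma cutoff_span_schwartz : cutoff_span `<=` @schwartz R n.
Proof.
apply: schwartz_coind => f; elim=> {f} [Q g tg|f g _ [c1 d1 b1] _ [c2 d2 b2]]; split.
- apply: ccontinuousM; first exact: cutoff_continuous.
  exact/smooth_continuous/tg.1.
- move=> i; exists (fun x =>
    (cutoff (fun j => if j == i then (Q i)^`() * 'X * (1 - 'X) else Q j) x)%:C
      * g x + (cutoff Q x)%:C * partial i g x).
    by apply: cutoff_add; apply: cutoff_mul => //; exact: smooth_torus_partial.
  move=> x; apply: has_partialM; first exact: cutoff_has_partial.
  exact/smooth_has_partial/tg.1.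
- move=> a; have [M hM] := cutoff_decay Q a.
  have [B B0 hB] := smooth_torus_bounded tg.
  exists (M * B) => x; rewrite cmodM mulrA cmodR ler_pM//.
  exact: cmod_ge0.
- exact: ccontinuousD.
- move=> i; have [f' Pf' hf'] := d1 i; have [g' Pg' hg'] := d2 i.
  exists (fun x => f' x + g' x); first exact: cutoff_add.
  by move=> x; exact: has_partialD.
- move=> a; have [M hM] := b1 a; have [M' hM'] := b2 a.
  exists (M + M') => x.
  by rewrite (le_trans (ler_wpM2l _ (cmodD _ _)))// mulrDr lerD.
Qed.

(** The Weierstrass product inequality: the errors of the n one-dimensional telescoping sums at
    worst add up. *)
Lemma prod1B_ge (I : Type) (r : seq I) (e : I -> R) :
  (forall t, 0 <= e t <= 1) ->
  1 - \sum_(t <- r) e t <= \prod_(t <- r) (1 - e t) <= 1.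
Proof.
move=> e01; elim: r => [|t r /andP[h1 h2]].
  by rewrite !big_nil subr0 lexx.
have /andP[e0 e1] := e01 t.
rewrite !big_cons; apply/andP; split; last first.
  by rewrite mulr_ile1 ?subr_ge0 ?gerBl//; apply: prodr_ge0 => j _;
    have /andP[_] := e01 j; rewrite subr_ge0.
have s0 : 0 <= \sum_(t <- r) e t.
  by apply: sumr_ge0 => j _; have /andP[] := e01 j.
nra.
Qed.

Lemma cutoffX_partition_of_unity x :
  sumZ (fun k => (cutoff (fun=> 'X) (x + (2 * pi) *: ZnR R k))%:C) = 1.
Proof.
have sc : schwartz (fun y => (cutoff (fun=> 'X) y)%:C).
  apply: cutoff_span_schwartz.
  have := @cutoff_mul (fun=> 'X) _ (smooth_torus_cst n (1 : C)).
  by under eq_fun do rewrite mulr1.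
apply: sumZ_unique; first exact: (schwartz_wbounded x sc).
pose K := \sum_(i < n) (expR (- x 0 i) + expR (x 0 i)).
have K0 : 0 <= K by apply: sumr_ge0 => i _; rewrite addr_ge0 ?expR_ge0.
(* This choice gives K / (m + 1) <= e, and K / (m + 1) will bound the sum of the coordinate errors
   [E i]. *)
move=> e e0; exists (Num.truncn (K / e)) => m hm.
have Km : K / m.+1%:R <= e.
  rewrite ler_pdivrMr// mulrC -ler_pdivrMr// (le_trans (ltW (truncnS_gt _)))//.
  by rewrite ler_nat ltnS.
(* [E i] is what the telescoping sum in coordinate i misses from 1. *)
pose E i := sigmoid (- (x 0 i + 2 * pi * m%:R)) + sigmoid (x 0 i - 2 * pi * m.+1%:R).
have -> : \sum_(k <- box n m) (cutoff (fun=> 'X) (x + (2 * pi) *: ZnR R k))%:C =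
    (\prod_i (1 - E i))%:C.
  rewrite -(rmorph_sum (real_complex R)); congr (_%:C).
  rewrite big_box /cutoff; under [RHS]eq_bigr do rewrite -sum_bump.
  rewrite bigA_distr_bigA; apply: eq_bigr => f _; apply: eq_bigr => i _.
  by rewrite !mxE.
have EE i : 0 <= E i <= (expR (- x 0 i) + expR (x 0 i)) / m.+1%:R.
  rewrite addr_ge0 ?sigmoid_ge0//=.
  (* A rate 1/(m + 1) suffices, so exp(2 pi j) >= 1 + 2 pi j >= 1 + m replaces the true exponential
     rate. *)
  have h (a : R) j : (m <= j)%N -> sigmoid (a - 2 * pi * j%:R) <= expR a / m.+1%:R.
    move=> mj; rewrite (le_trans (sigmoid_le_expR _))// expRD ler_wpM2l ?expR_ge0//.
    rewrite expRN lef_pV2 ?posrE ?expR_gt0//.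
    rewrite (le_trans _ (expR_ge1Dx _))// -natr1 addrC lerD2l.
    rewrite (@le_trans _ _ j%:R) ?ler_nat// ler_peMl//.
    by have := pi_ge1 R; lra.
  by rewrite /E opprD [leRHS]mulrDl lerD ?h.
have E1 i : 0 <= E i <= 1.
  have /andP[-> _] := EE i; rewrite /E.
  have : sigmoid (x 0 i - 2 * pi * m.+1%:R) <= sigmoid (x 0 i + 2 * pi * m%:R).
    apply: sigmoid_nondecreasing; rewrite lerD2l.
    rewrite (@le_trans _ _ 0)// ?oppr_le0 ?mulr_ge0 ?pi_ge0//.
  by have := sigmoidN (x 0 i + 2 * pi * m%:R); lra.
rewrite -(rmorph1 (real_complex R)) -(rmorphB (real_complex R)) cmodR.
have /andP[h1 h2] := prod1B_ge (index_enum _) E1.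
rewrite ger0_norm ?subr_ge0// (le_trans _ Km)//.
rewrite (@le_trans _ _ (\sum_i E i))//; first by lra.
by rewrite /K mulr_suml; apply: ler_sum => i _; have /andP[] := EE i.
Qed.

Lemma periodization_surj :
  set_surj (@schwartz R n) (@smooth_torus R n) (@periodization R n).
Proof.
move=> g tg; exists (fun x => (cutoff (fun=> 'X) x)%:C * g x).
  exact/cutoff_span_schwartz/cutoff_mul.
apply/funext => x; rewrite /periodization.
have sc : schwartz (fun y => (cutoff (fun=> 'X) y)%:C).
  apply: cutoff_span_schwartz.
  have := @cutoff_mul (fun=> 'X) _ (smooth_torus_cst n (1 : C)).
  by under eq_fun do rewrite mulr1.
under eq_fun do rewrite tg.2 mulrC.
by rewrite sumZZ ?cutoffX_partition_of_unity ?mulr1//; exact: (schwartz_wbounded x sc).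
Qed.

End surjectivity.

(** * Translation invariance and measurability *)

Section lebesgue_translation.
Context (R : realType).
Local Notation pushforward_measure :=
  measure_function_pushforward__canonical__measure_function_Measure.
Local Notation RT := (measurableTypeR R).
Local Notation mu n := (@lebesgue_tuple R n).
Local Open Scope ereal_scope.

Lemma measurable_addr (a : R) : measurable_fun [set: RT] (fun x : RT => (x + a)%R : RT).
Proof. by apply: measurable_funD => //; exact: measurable_cst. Qed.

Lemma eq_pushforward_lebesgue (a : R) (A : set RT) : measurable A ->
  pushforward (@lebesgue_measure R) (fun x : RT => (x + a)%R : RT) A =
  lebesgue_measure A.
Proof.
move=> mA; apply/esym.
apply: (@lebesgue_measure_unique R
  (pushforward_measure (@lebesgue_measure R) (measurable_addr a))) => //.
move=> _ [[b c] _ <-] /=; rewrite /pushforward.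
rewrite (_ : _ @^-1` _ = [set` `](b - a)%R, (c - a)%R]%R]); last first.
  apply/seteqP; split => x /=; rewrite !in_itv/=.
    by rewrite ltrBlDr lerBrDr.
  by rewrite ltrBlDr lerBrDr.
rewrite !lebesgue_measure_itv/= !lte_fin ltrD2r; case: ifP => // _.
by rewrite -!EFinB opprB addrA subrK.
Qed.

Definition tshift n (v : 'rV[R]_n) (t : n.-tuple RT) : n.-tuple RT :=
  [tuple (tnth t i + v 0%R i)%R | i < n].

Lemma row_tshift n (v : 'rV[R]_n) t :
  row_of_tuple (tshift v t) = (row_of_tuple t + v)%R.
Proof. by apply/rowP => i; rewrite !mxE tnth_mktuple. Qed.

Lemma measurable_tshift n (v : 'rV[R]_n) : measurable_fun setT (tshift v).
Proof.
apply/measurable_fun_tnthP => i.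
rewrite (_ : _ \o _ = (fun x : RT => (x + v 0%R i)%R : RT) \o (@tnth n RT ^~ i)).
  by apply: measurableT_comp; [exact: measurable_addr|exact: measurable_tnth].
by apply/funext => t /=; rewrite tnth_mktuple.
Qed.

Lemma tshift_tcons n (v : 'rV[R]_n.+1) (p : RT * n.-tuple RT) :
  tshift v (tcons p) =
  tcons (((p.1 + v 0%R 0%R)%R : RT), tshift (\row_i v 0%R (lift ord0 i)) p.2).
Proof.
apply: eq_from_tnth => i; rewrite tnth_mktuple.
have [->|[j ->]] : i = ord0 \/ exists j, i = lift ord0 j.
  by case: (unliftP ord0 i) => [j ->|->]; [right; exists j|left].
  by rewrite !tnth0.
by rewrite !tnthS tnth_mktuple mxE.
Qed.

(** Induction on the dimension: the measure integrates the measures of sections over the first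
    coordinate. The induction hypothesis removes the shift inside the sections, and invariance on
    the line removes the shift of the first coordinate. *)
Lemma lebesgue_tuple_tshift n (v : 'rV[R]_n) (A : set (n.-tuple RT)) :
  measurable A -> mu n (tshift v @^-1` A) = mu n A.
Proof.
elim: n v A => [|n IH] v A mA.
  have e t : tshift v t = t by apply: eq_from_tnth => -[].
  by congr (mu 0 _); apply/seteqP; split => t /=; rewrite e.
have mB : measurable (@tcons R n @^-1` A).
  by rewrite -[X in measurable X]setTI; exact: (measurable_tcons).
set B := @tcons R n @^-1` A in mB.
transitivity (\int[@lebesgue_measure R]_x
    (((mu n : set _ -> \bar R) \o xsection B) \o
      (fun x : RT => (x + v 0%R 0%R)%R : RT)) x).
  rewrite [LHS]/=/tuple_measureS /pushforward /product_measure1.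
  apply: eq_integral => x _ /=; rewrite -[RHS](IH (\row_i v 0%R (lift ord0 i))).
    congr (mu n _); apply/seteqP; split => t; rewrite /xsection/= => /set_mem h;
      apply/mem_set; move: h; by rewrite /B/= tshift_tcons.
  exact: measurable_xsection.
have mf := @measurable_fun_xsection _ _ _ _ _ (mu n) _ mB.
rewrite -[LHS](ge0_integral_pushforward (measurable_addr (v 0%R 0%R)) lebesgue_measure
    measurableT) => //.
apply: (@eq_measure_integral _ _ _ _ _
  (pushforward_measure (@lebesgue_measure R) (measurable_addr (v 0%R 0%R)))) => C mC _.
exact: eq_pushforward_lebesgue.
Qed.

Lemma ge0_integral_tshift n (v : 'rV[R]_n) (D : set (n.-tuple RT))
    (F : n.-tuple RT -> \bar R) : measurable D -> measurable_fun D F ->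
  (forall t, 0 <= F t) ->
  \int[mu n]_(t in D) F t = \int[mu n]_(t in tshift v @^-1` D) F (tshift v t).
Proof.
move=> mD mF F0.
rewrite -(ge0_integral_pushforward (measurable_tshift v) (mu n) mD) => //.
apply: (@eq_measure_integral _ _ _ _
  (pushforward_measure (mu n) (measurable_tshift v))) => A mA _.
exact/esym/lebesgue_tuple_tshift.
Qed.

Lemma Rintegral_tshift n (v : 'rV[R]_n) (D : set (n.-tuple RT))
    (F : n.-tuple RT -> R) : measurable D -> measurable_fun setT F ->
  (mu n).-integrable (tshift v @^-1` D) (EFin \o (F \o tshift v)) ->
  (\int[mu n]_(t in D) F t = \int[mu n]_(t in tshift v @^-1` D) F (tshift v t))%R.
Proof.
move=> mD mF intF; congr fine.
have := @integral_pushforward _ _ _ _ _ _ (measurable_tshift v) (mu n) D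
  (EFin \o F).
rewrite /comp/= => <- //; last exact/measurable_EFinP.
apply: (@eq_measure_integral _ _ _ _
  (pushforward_measure (mu n) (measurable_tshift v))) => A mA _.
exact/esym/lebesgue_tuple_tshift.
Qed.

End lebesgue_translation.

(** * Measurability of continuous functions on R^n *)

Section row_measurability.
Context (R : realType) (n : nat).
Local Notation RT := (measurableTypeR R).
Local Notation Rn := 'rV[R]_n.
Local Notation Zn := 'rV[int]_n.
Local Notation row_ := (@row_of_tuple R n).

Lemma measurable_row_box (P : 'I_n -> set RT) : (forall i, measurable (P i)) ->
  measurable (row_ @^-1` [set x | forall i, P i (x 0 i)]).
Proof.
move=> mP.
rewrite (_ : _ @^-1` _ = \bigcap_(i in [set: 'I_n]) ((@tnth n RT ^~ i) @^-1` P i)).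
  apply: fin_bigcap_measurable => // i _.
  rewrite -[X in measurable X]setTI; exact: measurable_tnth.
apply/seteqP; split => t /= h i; first by have := h i; rewrite mxE.
by rewrite mxE; exact: h.
Qed.

(* A continuous function is the pointwise limit of functions that are constant
   on the cells of finer and finer grids, hence measurable for the product
   sigma-algebra. *)
Lemma continuous_measurable_row (h : Rn -> R) : continuous h ->
  measurable_fun setT (h \o row_).
Proof.
move=> ch.
pose cell (m : nat) (x : Rn) : Zn := \row_i Num.floor (m.+1%:R * x 0 i).
pose grid (m : nat) (k : Zn) : Rn := \row_i ((k 0 i)%:~R / m.+1%:R).
apply: (@measurable_realfun.measurable_fun_cvg _ _ _ _
  (fun m t => h (grid m (cell m (row_ t))))).
  move=> m _ B mB; rewrite setTI.
  rewrite (_ : _ @^-1` B = \bigcup_(k in [set: Zn])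
      [set t | h (grid m k) \in B /\ forall i, `[(k 0 i)%:~R / m.+1%:R,
        (k 0 i + 1)%:~R / m.+1%:R[%classic (row_ t 0 i)]); last first.
    have cellP (t : n.-tuple RT) (k : Zn) : (forall i, `[(k 0 i)%:~R / m.+1%:R,
        (k 0 i + 1)%:~R / m.+1%:R[%classic (row_ t 0 i)) <-> cell m (row_ t) = k.
      split=> [hk|<- i].
        apply/rowP => i; rewrite !mxE; apply: floor_def.
        have := hk i; rewrite /= in_itv/= ler_pdivrMr// ltr_pdivlMr//.
        by rewrite mxE mulrC.
      rewrite /= in_itv/= ler_pdivrMr// ltr_pdivlMr// [cell _ _ _ _]mxE.
      by rewrite [_ * m.+1%:R]mulrC floor_itv.
    apply/seteqP; split => [t /= Bt|t [k _ /= [hk /cellP]]].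
      exists (cell m (row_ t)) => //; split; first exact: mem_set.
      exact/cellP.
    by move=> ->; exact: set_mem.
  apply: countable_bigcupT_measurable; first exact: countableP.
  move=> k; have [hB|hB] := boolP (h (grid m k) \in B); last first.
    by rewrite (_ : mkset _ = set0)//; apply/seteqP; split => // t [].
  rewrite (_ : mkset _ = row_ @^-1` [set x | forall i,
     `[(k 0 i)%:~R / m.+1%:R, (k 0 i + 1)%:~R / m.+1%:R[%classic (x 0 i)]).
    by apply: (@measurable_row_box (fun i => `[(k 0 i)%:~R / m.+1%:R,
      (k 0 i + 1)%:~R / m.+1%:R[%classic)) => i; exact: measurable_itv.
  by apply/seteqP; split => t //= [].
move=> t _; apply: (@cvg_comp _ _ _ (fun m => grid m (cell m (row_ t))) h _
  (nbhs (row_ t))); last exact: ch.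
apply/cvg_ballP => e e0; near=> m; split => // i j; rewrite !mxE /ball/=.
have /andP[h1 h2] := floor_itv (m.+1%:R * tnth t j).
move: (Num.floor _) h1 h2 => z h1 h2.
have m0 : 0 < m.+1%:R :> R by [].
have hm : 1 / m.+1%:R < e.
  by rewrite div1r; near: m; exact: near_infty_natSinv_lt (PosNum e0).
rewrite ger0_norm ?subr_ge0; last by rewrite ler_pdivrMr// [leRHS]mulrC.
apply: le_lt_trans hm; rewrite lerBlDr -mulrDl ler_pdivlMr// [leLHS]mulrC addrC.
by move: h2; rewrite intrD mulr1z => /ltW.
Unshelve. all: by end_near. Qed.

End row_measurability.

(** * Tiling by cubes *)

Section cube_tiling.
Context (R : realType) (n : nat).
Local Notation RT := (measurableTypeR R).
Local Notation Rn := 'rV[R]_n.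
Local Notation Zn := 'rV[int]_n.
Local Notation row_ := (@row_of_tuple R n).
Local Notation mu := (@lebesgue_tuple R n).
Local Notation cube_ := (row_ @^-1` (@cube R n)).
Local Notation per k := ((2 * pi) *: ZnR R k).
Implicit Types (x y v : Rn) (k l : Zn).

Lemma pre_tshift v (D : set Rn) :
  tshift v @^-1` (row_ @^-1` D) = row_ @^-1` [set x | D (x + v)].
Proof. by apply/seteqP; split => t; rewrite /preimage/= row_tshift. Qed.

Lemma measurable_cube : measurable cube_.
Proof.
rewrite (_ : cube_ = row_ @^-1` [set x | forall i, `[0, 2 * pi[%classic (x 0 i)]).
  apply: (@measurable_row_box R n (fun=> `[0, 2 * pi[%classic)) => i.
  exact: measurable_itv.
by apply/seteqP; split => t h i; have := h i; rewrite /= in_itv.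
Qed.

Definition tile k : set (n.-tuple RT) := row_ @^-1` [set x | cube (x - per k)].

Lemma measurable_tile k : measurable (tile k).
Proof.
rewrite /tile -(pre_tshift (- per k) (@cube R n)) -[X in measurable X]setTI.
by apply: measurable_tshift => //; exact: measurable_cube.
Qed.

Lemma tshift_tile k : tshift (per k) @^-1` tile k = cube_.
Proof.
rewrite /tile pre_tshift; apply/seteqP; split => t;
  by rewrite /preimage/= addrK.
Qed.

Lemma cubeP x k l : cube (x - per k) -> cube (x - per l) -> k = l.
Proof.
move=> hk hl; apply/rowP => i; have := hk i; have := hl i; rewrite !mxE.
move: (k 0 i) (l 0 i) (x 0 i) => a b u /andP[h1 h2] /andP[h3 h4].
have p0 : 0 < 2 * pi :> R by rewrite mulr_gt0// pi_gt0.
have ab : `|(2 * pi) * (a - b)%:~R| < 2 * pi :> R.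
  by rewrite intrB mulrBr ltr_norml; apply/andP; split; lra.
move: ab; rewrite normrM gtr0_norm// gtr_pMr// -intr_norm.
rewrite -[1]/(1%:~R) ltr_int => ab; apply/eqP; rewrite -subr_eq0 -normr_eq0.
by rewrite eq_le normr_ge0 andbT -ltzD1 add0r.
Qed.

Lemma trivIset_tile (D : set Zn) : trivIset D tile.
Proof.
apply/trivIsetP => k l _ _; apply: contra_neqP => /eqP/set0P[t [tk tl]].
exact: cubeP tk tl.
Qed.

Definition tiles (J : {fset Zn}) : set (n.-tuple RT) :=
  \big[setU/set0]_(k <- J) tile k.

Lemma tilesE (J : {fset Zn}) t : tiles J t <-> exists2 k, k \in J & tile k t.
Proof. by rewrite /tiles -bigcup_seq; split=> [[k kJ kt]|[k kJ kt]]; exists k. Qed.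

Lemma measurable_tiles J : measurable (tiles J).
Proof. by apply: bigsetU_measurable => k _; exact: measurable_tile. Qed.

Lemma tiles_nondecreasing :
  {homo (fun m => tiles (box n m)) : m m' / (m <= m')%N >-> (m <= m')%O}.
Proof.
move=> m m' mm'; apply/subsetPset => t /tilesE[k km kt]; apply/tilesE.
by exists k => //; exact: (fsubsetP (box_subset n mm')).
Qed.

Lemma bigcup_tiles : \bigcup_m tiles (box n m) = setT.
Proof.
rewrite -subTset => t _; have [k hk] := translate_to_cube 0 (row_ t).
have [m km] := @fset_sub_box n [fset k]%fset.
exists m => //; apply/tilesE; exists k; first by apply: (fsubsetP km); rewrite inE.
by move=> i; have := hk i; rewrite !mxE add0r.
Qed.

Lemma ge0_integral_tiles (J : {fset Zn}) (F : Rn -> R) :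
  measurable_fun setT (F \o row_) -> (forall x, 0 <= F x) ->
  (\int[mu]_(t in tiles J) (F (row_ t))%:E =
  \sum_(k <- J) \int[mu]_(t in cube_) (F (row_ t + per k))%:E)%E.
Proof.
move=> mF F0; rewrite ge0_integral_bigsetU//=; first last.
- by move=> t _; rewrite lee_fin.
- by apply: measurable_funTS; exact/measurable_EFinP.
- exact: trivIset_tile.
- exact: measurable_tile.
apply: eq_bigr => k _; rewrite (ge0_integral_tshift (per k)).
- by rewrite tshift_tile; under eq_integral do rewrite row_tshift.
- exact: measurable_tile.
- by apply: measurable_funTS; exact/measurable_EFinP.
- by move=> t; rewrite lee_fin.
Qed.

Lemma integrable_tshift (F : Rn -> R) v (D : set Rn) :
  measurable (row_ @^-1` D) -> measurable_fun setT (F \o row_) ->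
  mu.-integrable (row_ @^-1` D) (fun t => (F (row_ t))%:E) ->
  mu.-integrable (row_ @^-1` [set x | D (x + v)])
    (fun t => (F (row_ t + v))%:E).
Proof.
move=> mD mF /integrableP[_ Foo]; apply/integrableP; split.
  apply: measurable_funTS; apply/measurable_EFinP.
  rewrite (_ : (fun t => _) = (F \o row_) \o tshift v).
    by apply: measurableT_comp => //; exact: measurable_tshift.
  by apply/funext => t; rewrite /= row_tshift.
move: Foo; rewrite (ge0_integral_tshift v) ?pre_tshift//; last first.
  by apply: measurable_funTS; apply: measurableT_comp => //; exact/measurable_EFinP.
by under eq_integral do rewrite row_tshift.
Qed.

Lemma Rintegral_row_shift (F : Rn -> R) v (D : set Rn) :
  measurable (row_ @^-1` D) -> measurable_fun setT (F \o row_) ->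
  mu.-integrable (row_ @^-1` D) (fun t => (F (row_ t))%:E) ->
  \int[mu]_(t in row_ @^-1` D) F (row_ t) =
  \int[mu]_(t in row_ @^-1` [set x | D (x + v)]) F (row_ t + v).
Proof.
move=> mD mF intF; rewrite (Rintegral_tshift (v := v))//; last first.
  rewrite pre_tshift (_ : EFin \o _ = (fun t => (F (row_ t + v))%:E)).
    exact: integrable_tshift.
  by apply/funext => t /=; rewrite row_tshift.
by rewrite pre_tshift; under eq_Rintegral do rewrite row_tshift.
Qed.

Lemma Rintegral_tiles (J : {fset Zn}) (F : Rn -> R) :
  measurable_fun setT (F \o row_) ->
  mu.-integrable setT (fun t => (F (row_ t))%:E) ->
  \int[mu]_(t in tiles J) F (row_ t) =
  \sum_(k <- J) \int[mu]_(t in cube_) F (row_ t + per k).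
Proof.
move=> mF intF; rewrite /Rintegral integral_bigsetU_EFin//=; first last.
- by apply: measurable_funTS; exact/measurable_EFinP.
- exact: trivIset_tile.
- exact: measurable_tile.
have intk k : mu.-integrable (tile k) (fun t => (F (row_ t))%:E).
  by apply: integrableS intF => //; exact: measurable_tile.
rewrite -sum_fine; last first.
  by move=> k _; apply: integrable_fin_num => //; exact: measurable_tile.
apply: eq_bigr => k _.
have := @Rintegral_row_shift F (per k) [set x | cube (x - per k)]
  (measurable_tile k) mF (intk k).
rewrite /Rintegral => ->; rewrite -pre_tshift.
by rewrite -/(tile k) tshift_tile.
Qed.

(** Dominated convergence for the restrictions of F to growing unions of tiles, with |F| as
    majorant. *)
Lemma cvg_sum_tiles (F : Rn -> R) :
  measurable_fun setT (F \o row_) ->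
  mu.-integrable setT (fun t => (F (row_ t))%:E) ->
  (fun m => \sum_(k <- box n m) \int[mu]_(t in cube_) F (row_ t + per k)) @ \oo
    --> \int[mu]_(t in setT) F (row_ t).
Proof.
move=> mF intF.
under eq_cvg do rewrite -Rintegral_tiles//.
apply: fine_cvg; rewrite fineK; last exact: integrable_fin_num.
under eq_cvg do rewrite integral_mkcond.
apply: (@dominated_cvg _ _ _ _ _ measurableT _ _
  (fun t => `|(F (row_ t))%:E|%E)) => //.
- move=> m; apply/(measurable_restrictT _ (measurable_tiles _)).
  by apply: measurable_funTS; exact/measurable_EFinP.
- move=> t _; apply: cvg_near_cst.
  have [m _ tm] : (\bigcup_m tiles (box n m)) t by rewrite bigcup_tiles.
  exists m => // m' /= mm'; rewrite patchE mem_set//.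
  by have /subsetPset := tiles_nondecreasing mm'; exact.
- exact: integrable_abse.
- move=> m t _; rewrite patchE; case: ifPn => // _.
  by rewrite abse0 abse_ge0.
Qed.

(** The monotone counterpart, with extended real values, so that it can serve to establish
    integrability in [decaying_L1norm]. *)
Lemma ge0_cvg_sum_tiles (F : Rn -> R) :
  measurable_fun setT (F \o row_) -> (forall x, 0 <= F x) ->
  ((fun m => \sum_(k <- box n m) \int[mu]_(t in cube_) (F (row_ t + per k))%:E) @ \oo
    --> \int[mu]_(t in setT) (F (row_ t))%:E)%E.
Proof.
move=> mF F0.
under eq_cvg do rewrite -ge0_integral_tiles//.
rewrite -bigcup_tiles; apply: ge0_nondecreasing_set_cvg_integral.
- exact: tiles_nondecreasing.
- by move=> m; exact: measurable_tiles.
- by move=> m; apply: measurable_funTS; exact/measurable_EFinP.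
- by move=> m t _; rewrite lee_fin.
Qed.

End cube_tiling.

Lemma lebesgue_cube (R : realType) n :
  @lebesgue_tuple R n (@row_of_tuple R n @^-1` (@cube R n)) = ((2 * pi) ^+ n)%:E.
Proof.
elim: n => [|n IH].
  (* In dimension 0 the measure is the unit mass at the empty tuple, which lies in the cube. *)
  rewrite expr0 /= /dirac indicE mem_set// => -[]//.
rewrite /= /tuple_measureS /pushforward.
rewrite (_ : _ @^-1` _ =
  (`[0, 2 * pi[%classic `*` (@row_of_tuple R n @^-1` (@cube R n)))); last first.
  apply/seteqP; split => -[x t] /=.
    move=> h; split.
      by have := h ord0; rewrite mxE tnth0 /= in_itv.
    by move=> i; have := h (lift ord0 i); rewrite !mxE tnthS.
  move=> [h0 h] i; rewrite mxE.
  have [->|[j ->]] : i = ord0 \/ exists j, i = lift ord0 j.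
    by case: (unliftP ord0 i) => [j ->|->]; [right; exists j|left].
    by move: h0; rewrite tnth0 /= in_itv.
  by have := h j; rewrite mxE tnthS.
rewrite product_measure1E//; last exact: measurable_cube.
have e : @lebesgue_measure R `[0, 2 * pi[%classic = (2 * pi)%:E.
  by rewrite lebesgue_measure_itv/= lte_fin mulr_gt0 ?pi_gt0// -EFinB subr0.
apply: (@eq_trans _ _ ((2 * pi)%:E * ((2 * pi) ^+ n)%:E)%E); last first.
  by rewrite -EFinM exprS.
by congr (_ * _)%E; [exact: e|exact: IH].
Qed.

(** * Integration over the fundamental cube *)

Section cube_integral.
Context (R : realType) (n : nat).
Local Notation C := R[i].
Local Notation RT := (measurableTypeR R).
Local Notation Rn := 'rV[R]_n.
Local Notation Zn := 'rV[int]_n.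
Local Notation row_ := (@row_of_tuple R n).
Local Notation mu := (@lebesgue_tuple R n).
Local Notation cube_ := (row_ @^-1` (@cube R n)).
Local Notation per k := ((2 * pi) *: ZnR R k).
Local Notation e_ i := (delta_mx 0 i : Rn).
Local Notation cint := (cintegral (@cube R n)).
Implicit Types (x y v : Rn) (k l : Zn) (F G : Rn -> C).

Lemma bounded_integrable_cube (h : Rn -> R) (M : R) (D : set (n.-tuple RT)) :
  measurable D -> D `<=` cube_ ->
  measurable_fun setT (h \o row_) -> (forall x, `|h x| <= M) ->
  mu.-integrable D (fun t => (h (row_ t))%:E).
Proof.
move=> mD DC mh hM; apply: (@measurable_bounded_integrable _ _ _ mu (h \o row_)) => //.
- apply: (@le_lt_trans _ _ (mu cube_)).
    by apply: le_measure => //; apply: mem_set => //; exact: measurable_cube.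
  by rewrite lebesgue_cube ltry.
- exact: measurable_funTS.
- exists M; split; first exact: num_real.
  by move=> r Mr t _ /=; rewrite (le_trans (hM _))// ltW.
Qed.

(** The translated cube is no longer the cube, so the domain is cut at x_j = 2 pi - t. The lower
    slab [D0] moves by t onto [E0]; the upper slab [D1] sticks out and is brought back by a period
    onto [E1]. Together [E0] and [E1] refill the cube. *)
Lemma Rintegral_cube_shift (h : Rn -> R) (M : R) (j : 'I_n) (t : R) :
  continuous h -> (forall x, `|h x| <= M) -> (forall x k, h (x + per k) = h x) ->
  0 <= t < 2 * pi ->
  \int[mu]_(u in cube_) h (row_ u + t *: e_ j) = \int[mu]_(u in cube_) h (row_ u).
Proof.
move=> ch hM hp /andP[t0 t2].
have mh := continuous_measurable_row ch.
have mco (i : interval R) : measurable (row_ @^-1` [set x | cube x /\ x 0 j \in i]).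
  rewrite (_ : _ @^-1` _ = cube_ `&` (@tnth n RT ^~ j) @^-1` [set` i]).
    apply: measurableI; first exact: measurable_cube.
    by rewrite -[X in measurable X]setTI; apply: measurable_tnth.
  by apply/seteqP; split => u [/= ? +]; rewrite ?mxE; split=> //; rewrite ?mxE.
have splt (a : R) : cube_ = row_ @^-1` [set x | cube x /\ x 0 j \in `]-oo, a[] `|`
    row_ @^-1` [set x | cube x /\ x 0 j \in `[a, +oo[].
  apply/seteqP; split => [u /= cu|u [[]|[]]//].
  rewrite !in_itv/= andbT.
  by case: (ltP (row_ u 0 j) a) => ha; [left|right].
have dsj (a : R) : [disjoint row_ @^-1` [set x | cube x /\ x 0 j \in `]-oo, a[] &
    row_ @^-1` [set x | cube x /\ x 0 j \in `[a, +oo[]].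
  apply/disj_setPS => u [[_ /=]]; rewrite in_itv/= => h1 [_ /=].
  by rewrite in_itv/= andbT leNgt h1.
pose D0 := [set x : Rn | cube x /\ x 0 j \in `]-oo, 2 * pi - t[].
pose D1 := [set x : Rn | cube x /\ x 0 j \in `[2 * pi - t, +oo[].
pose E0 := [set x : Rn | cube x /\ x 0 j \in `[t, +oo[].
pose E1 := [set x : Rn | cube x /\ x 0 j \in `]-oo, t[].
have mE0 : measurable (row_ @^-1` E0) by exact: mco.
have mE1 : measurable (row_ @^-1` E1) by exact: mco.
(* The period that carries the protruding slab back into the cube. *)
pose k : Zn := - delta_mx 0 j.
have kE : per k = - ((2 * pi) *: e_ j).
  rewrite /k ZnRN scalerN; congr (- (_ *: _)).
  by apply/rowP => i; rewrite !mxE; case: (_ && _).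
have sE0 : [set x : Rn | E0 (x + t *: e_ j)] = D0.
  apply/seteqP; split => x; rewrite /E0 /D0 /= !in_itv/= !andbT => -[cx hx];
      have jx := cx j; move: hx jx; rewrite !mxE !eqxx mulr1 => hx jx; split.
  - move=> i; have := cx i; rewrite !mxE eqxx/=.
    case: eqVneq => [->|_]; last by rewrite mulr0 addr0.
    by rewrite mulr1; lra.
  - lra.
  - move=> i; rewrite !mxE eqxx/=; have := cx i.
    case: eqVneq => [->|_]; last by rewrite mulr0 addr0.
    by rewrite mulr1; lra.
  - lra.
have sE1 : [set x : Rn | E1 (x + (t *: e_ j + per k))] = D1.
  rewrite kE; apply/seteqP; split => x; rewrite /E1 /D1 /= !in_itv/= !andbT => -[cx hx];
      have jx := cx j; move: hx jx; rewrite !mxE !eqxx !mulr1 => hx jx; split.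
  - move=> i; have := cx i; rewrite !mxE eqxx/=.
    case: eqVneq => [->|_]; last by rewrite !mulr0 subr0 addr0.
    by rewrite !mulr1; lra.
  - lra.
  - move=> i; rewrite !mxE eqxx/=; have := cx i.
    case: eqVneq => [->|_]; last by rewrite !mulr0 subr0 addr0.
    by rewrite !mulr1; lra.
  - lra.
have mht v : measurable_fun setT ((fun x => h (x + v)) \o row_).
  rewrite (_ : _ \o _ = (h \o row_) \o tshift v).
    by apply: measurableT_comp => //; exact: measurable_tshift.
  by apply/funext => u; rewrite /= row_tshift.
have intT v (D : set (n.-tuple RT)) : measurable D -> D `<=` cube_ ->
   mu.-integrable D (fun u => (h (row_ u + v))%:E).
  by move=> mD DC; apply: (@bounded_integrable_cube (fun x => h (x + v)) M).
have int0 (D : set (n.-tuple RT)) : measurable D -> D `<=` cube_ ->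
   mu.-integrable D (fun u => (h (row_ u))%:E).
  by move=> mD DC; apply: (@bounded_integrable_cube h M).
transitivity (\int[mu]_(u in row_ @^-1` D0) h (row_ u + t *: e_ j) +
              \int[mu]_(u in row_ @^-1` D1) h (row_ u + t *: e_ j)).
  rewrite (splt (2 * pi - t)) Rintegral_setU//.
  by rewrite -splt; apply: intT => //; exact: measurable_cube.
rewrite (splt t) Rintegral_setU//; last first.
  by rewrite -splt; apply: int0 => //; exact: measurable_cube.
rewrite addrC; congr (_ + _).
  rewrite (@Rintegral_row_shift R n h (t *: e_ j + per k) E1)//; last first.
    by apply: int0 => // u [].
  rewrite sE1; apply: eq_Rintegral => u _.
  by rewrite addrA hp.
rewrite (@Rintegral_row_shift R n h (t *: e_ j) E0)//; last first.
  by apply: int0 => // u [].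
by rewrite sE0.
Qed.

(** A class stable under the algebraic operations and translations in use, on which integrability
    over the cube is automatic, the cube having finite measure. *)
Definition cbounded F := ccontinuous F /\ exists M : R, forall x, cmod (F x) <= M.

Lemma cboundedD F G : cbounded F -> cbounded G -> cbounded (fun x => F x + G x).
Proof.
move=> [cF [M hM]] [cG [N hN]]; split; first exact: ccontinuousD.
by exists (M + N) => x; rewrite (le_trans (cmodD _ _))// lerD.
Qed.

Lemma cboundedM F G : cbounded F -> cbounded G -> cbounded (fun x => F x * G x).
Proof.
move=> [cF [M hM]] [cG [N hN]]; split; first exact: ccontinuousM.
by exists (M * N) => x; rewrite cmodM ler_pM// cmod_ge0.
Qed.

Lemma cbounded_cst (c : C) : cbounded (fun=> c).
Proof. by split; [exact: ccontinuous_cst|exists (cmod c)]. Qed.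

Lemma cboundedZ (c : C) F : cbounded F -> cbounded (fun x => c * F x).
Proof. by move=> cF; apply: cboundedM => //; exact: cbounded_cst. Qed.

Lemma cboundedB F G : cbounded F -> cbounded G -> cbounded (fun x => F x - G x).
Proof.
move=> cF cG; have := cboundedD cF (cboundedZ (-1) cG).
by under eq_fun do rewrite mulN1r.
Qed.

Lemma cbounded_sum (I : Type) (r : seq I) (F : I -> Rn -> C) :
  (forall i, cbounded (F i)) -> cbounded (fun y => \sum_(i <- r) F i y).
Proof.
move=> cF; elim: r => [|k r IH].
  by under eq_fun do rewrite big_nil; exact: cbounded_cst.
by under eq_fun do rewrite big_cons; exact: cboundedD.
Qed.

Lemma cbounded_shift F v : cbounded F -> cbounded (fun x => F (x + v)).
Proof.
move=> [cF [M hM]]; split; first exact: ccontinuous_shift.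
by exists M.
Qed.

Lemma cbounded_integrable_Re F : cbounded F ->
  mu.-integrable cube_ (fun t => (complex.Re (F (row_ t)))%:E).
Proof.
move=> [[c1 c2] [M hM]].
apply: (@bounded_integrable_cube (@complex.Re R \o F) M) => //.
- exact: measurable_cube.
- exact: continuous_measurable_row.
- by move=> x; exact: le_trans (cmod_Re _) (hM x).
Qed.

Lemma cbounded_integrable_Im F : cbounded F ->
  mu.-integrable cube_ (fun t => (complex.Im (F (row_ t)))%:E).
Proof.
move=> [[c1 c2] [M hM]].
apply: (@bounded_integrable_cube (@complex.Im R \o F) M) => //.
- exact: measurable_cube.
- exact: continuous_measurable_row.
- by move=> x; exact: le_trans (cmod_Im _) (hM x).
Qed.

Lemma cintegralD F G : cbounded F -> cbounded G ->
  cint (fun x => F x + G x) = cint F + cint G.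
Proof.
move=> cF cG; apply: complexP; rewrite ?Re_add ?Im_add /=.
  rewrite -RintegralD; [|exact: measurable_cube|exact: cbounded_integrable_Re..].
  by apply: eq_Rintegral => t _; rewrite Re_add.
rewrite -RintegralD; [|exact: measurable_cube|exact: cbounded_integrable_Im..].
by apply: eq_Rintegral => t _; rewrite Im_add.
Qed.

Lemma cintegralZ (c : C) F : cbounded F ->
  cint (fun x => c * F x) = c * cint F.
Proof.
move=> cF; have mC := @measurable_cube R n.
have intZ (r : R) (h : n.-tuple RT -> R) : mu.-integrable cube_ (EFin \o h) ->
    mu.-integrable cube_ (EFin \o (fun t => r * h t)).
  by move=> ih; have := integrableZl mC r ih; under eq_fun do rewrite -EFinM.
have iR := cbounded_integrable_Re cF; have iI := cbounded_integrable_Im cF.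
apply: complexP; rewrite ?Re_mul ?Im_mul /=.
  rewrite -RintegralZl// -RintegralZl// -RintegralB; [|exact: mC|exact: intZ..].
  by apply: eq_Rintegral => t _; rewrite Re_mul.
rewrite -RintegralZl// -RintegralZl// -RintegralD; [|exact: mC|exact: intZ..].
by apply: eq_Rintegral => t _; rewrite Im_mul.
Qed.

Lemma cintegral0 : cint (fun=> 0) = 0.
Proof.
by apply: complexP; rewrite /= Rintegral_cst ?mul0r//; exact: measurable_cube.
Qed.

Lemma cintegral_cst (c : C) :
  cint (fun=> c) = c * ((2 * pi) ^+ n)%:C.
Proof.
have mC := @measurable_cube R n.
have e : fine (mu cube_) = (2 * pi) ^+ n by rewrite lebesgue_cube.
apply: complexP; rewrite ?Re_mul ?Im_mul /= Rintegral_cst// e mulr0.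
  by rewrite subr0.
by rewrite add0r.
Qed.

Lemma cintegral_sum (I : Type) (r : seq I) (F : I -> Rn -> C) :
  (forall i, cbounded (F i)) ->
  cint (fun x => \sum_(i <- r) F i x) =
  \sum_(i <- r) cint (F i).
Proof.
move=> cF; elim: r => [|k r IH].
  by rewrite big_nil; under eq_fun do rewrite big_nil; exact: cintegral0.
rewrite big_cons -IH; under eq_fun do rewrite big_cons.
by rewrite cintegralD//; exact: cbounded_sum.
Qed.

Lemma cintegralB F G : cbounded F -> cbounded G ->
  cint (fun x => F x - G x) = cint F - cint G.
Proof.
move=> cF cG; rewrite -[X in _ = _ + X]mulN1r -cintegralZ//.
rewrite -cintegralD//; last exact: cboundedZ.
by congr cintegral; apply/funext => x; rewrite mulN1r.
Qed.

(** The factor 2 comes from estimating real and imaginary parts separately. The majorant is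
    integrated as a complex function so that the rules for [cintegral] apply to it. *)
Lemma cmod_cintegral_le F (w : Rn -> R) : cbounded F -> cbounded (fun x => (w x)%:C) ->
  (forall x, cube x -> cmod (F x) <= w x) ->
  cmod (cint F) <= 2 * complex.Re (cint (fun x => (w x)%:C)).
Proof.
move=> cF cw hw; have mC := @measurable_cube R n.
have iw := cbounded_integrable_Re cw.
have iR := cbounded_integrable_Re cF; have iI := cbounded_integrable_Im cF.
rewrite (mulr_natl _ 2) mulr2n (le_trans (cmod_leD _))// lerD//=.
  rewrite (le_trans (le_normr_Rintegral _ _))//; apply: le_Rintegral => //.
    exact: (integrable_abse iR).
  by move=> t ct; rewrite (le_trans (cmod_Re _))// hw.
rewrite (le_trans (le_normr_Rintegral _ _))//; apply: le_Rintegral => //.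
  exact: (integrable_abse iI).
by move=> t ct; rewrite (le_trans (cmod_Im _))// hw.
Qed.

Lemma cmod_cintegral_le_cst F (M : R) : cbounded F ->
  (forall x, cube x -> cmod (F x) <= M) ->
  cmod (cint F) <= 2 * M * (2 * pi) ^+ n.
Proof.
move=> cF hM; have := cmod_cintegral_le cF (cbounded_cst M%:C) hM.
by rewrite cintegral_cst Re_mul/= mulr0 subr0 mulrA.
Qed.

Lemma cintegral_shift F (j : 'I_n) (t : R) : cbounded F ->
  (forall x k, F (x + per k) = F x) -> 0 <= t < 2 * pi ->
  cint (fun x => F (x + t *: e_ j)) = cint F.
Proof.
move=> [[c1 c2] [M hM]] pF t02; apply: complexP => /=.
  apply: (@Rintegral_cube_shift (@complex.Re R \o F) M) => //.
    by move=> x; exact: le_trans (cmod_Re _) (hM x).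
  by move=> x k /=; rewrite pF.
apply: (@Rintegral_cube_shift (@complex.Im R \o F) M) => //.
  by move=> x; exact: le_trans (cmod_Im _) (hM x).
by move=> x k /=; rewrite pF.
Qed.

End cube_integral.

(** * Fourier coefficients *)

Section integrals_over_space.
Context (R : realType) (n : nat).
Local Notation C := R[i].
Local Notation RT := (measurableTypeR R).
Local Notation Rn := 'rV[R]_n.
Local Notation Zn := 'rV[int]_n.
Local Notation row_ := (@row_of_tuple R n).
Local Notation mu := (@lebesgue_tuple R n).
Local Notation cube_ := (row_ @^-1` (@cube R n)).
Local Notation per k := ((2 * pi) *: ZnR R k).
Implicit Types (x y v : Rn) (k l : Zn) (F G f : Rn -> C).

(** Domination by the weight, uniformly over the cube. No derivatives enter, so a Schwartz function
    times a character, the integrand of [fourierR], qualifies at once. *)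
Definition decaying F := ccontinuous F /\
  exists A : R, forall x k, cube x -> cmod (F (x + per k)) <= A * weight R k.

Lemma weight_le1 k : weight R k <= 1.
Proof.
rewrite -[leRHS](@big1_eq _ 1 *%R _ (index_enum 'I_n) xpredT); apply: ler_prod => i _.
rewrite invr_ge0 addr_ge0 ?sqr_ge0//= invf_le1 ?ltr_pwDl ?sqr_ge0//.
by rewrite lerDl sqr_ge0.
Qed.

Lemma decaying_cbounded F : decaying F -> cbounded F.
Proof.
move=> [cF [A hA]]; split => //; exists `|A| => x.
have [k hk] := translate_to_cube 0 x.
have cx : cube (x - per k) by move=> i; have := hk i; rewrite !mxE add0r.
rewrite -(subrK (per k) x) (le_trans (hA _ k cx))//.
rewrite (le_trans (ler_wpM2r _ (ler_norm A)))// ?(ltW (weight_gt0 _ _))//.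
by rewrite -[leRHS]mulr1 ler_wpM2l// weight_le1.
Qed.

Lemma ccontinuous_cmod F : ccontinuous F -> continuous (fun x => cmod (F x)).
Proof.
move=> [c1 c2] x.
pose a := @complex.Re R \o F; pose b := @complex.Im R \o F.
rewrite (_ : (fun x => cmod (F x)) = Num.sqrt \o ((a \* a) \+ (b \* b))); last first.
  by apply/funext => y; rewrite /a /b /cmod /= -!expr2; case: (F y).
apply: continuous_comp; last exact: sqrt_continuous.
by apply: continuousD; apply: continuousM; [exact: c1..|exact: c2|exact: c2].
Qed.

Lemma measurable_cmod F : ccontinuous F ->
  measurable_fun setT ((fun x => cmod (F x)) \o row_).
Proof. by move=> cF; exact: (continuous_measurable_row (ccontinuous_cmod cF)). Qed.

(** On the tile of index k the integral is at most the volume of the cube times a multiple of the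
    weight of k. *)
Lemma decaying_L1norm F : decaying F -> (L1norm setT F < +oo)%E.
Proof.
move=> [cF [A hA]].
have h := @ge0_cvg_sum_tiles R n (fun x => cmod (F x)) (measurable_cmod cF)
  (fun x => cmod_ge0 _).
apply: (@le_lt_trans _ _ (`|A| * 5 ^+ n * (2 * pi) ^+ n)%:E); last exact: ltry.
rewrite /L1norm preimage_setT -(cvg_lim _ h)//.
apply: lime_le; first by apply/cvg_ex; eexists; exact: h.
apply: nearW => m.
rewrite (@le_trans _ _ (\sum_(k <- box n m) (`|A| * weight R k * (2 * pi) ^+ n)%:E)%E)//.
  apply: lee_sum => k _.
  rewrite (@le_trans _ _ (\int[mu]_(t in cube_) (`|A| * weight R k)%:E)%E)//.
    apply: ge0_le_integral => //.
    - exact: measurable_cube.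
    - by move=> t _; rewrite lee_fin cmod_ge0.
    - apply: measurable_funTS; apply/measurable_EFinP.
      exact: (measurable_cmod (ccontinuous_shift (per k) cF)).
    - move=> t ct; rewrite lee_fin (le_trans (hA _ _ ct))//.
      by rewrite ler_wpM2r ?ler_norm// ltW ?weight_gt0.
  rewrite integral_cst; last exact: measurable_cube.
  rewrite [X in (_ * X)%E](_ : _ = ((2 * pi) ^+ n)%:E); last exact: lebesgue_cube.
  by rewrite -EFinM.
rewrite sumEFin lee_fin -mulr_suml -mulr_sumr.
rewrite ler_wpM2r ?exprn_ge0 ?mulr_ge0 ?pi_ge0//.
by rewrite ler_wpM2l// sum_box_weight.
Qed.

Lemma decaying_integrable F (p : C -> R) : decaying F ->
  (forall z, `|p z| <= cmod z) -> continuous (p \o F) ->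
  mu.-integrable setT (fun t => (p (F (row_ t)))%:E).
Proof.
move=> dF pc cpF; apply/integrableP; split.
  by apply/measurable_EFinP; exact: (continuous_measurable_row cpF).
apply: le_lt_trans (decaying_L1norm dF); rewrite /L1norm preimage_setT.
apply: ge0_le_integral => //.
- apply: measurableT_comp => //; apply/measurable_EFinP.
  exact: (continuous_measurable_row cpF).
- apply/measurable_EFinP; exact: (measurable_cmod dF.1).
- by move=> t _; rewrite lee_fin.
Qed.

Lemma cintegral_setT_approx F : decaying F -> forall e : R, 0 < e ->
  exists m, forall m', (m <= m')%N ->
  cmod (cintegral setT F -
    \sum_(k <- box n m') cintegral (@cube R n) (fun x => F (x + per k))) <= e.
Proof.
move=> dF e e0; have [[c1 c2] _] := dF.
have mf (p : C -> R) : continuous (p \o F) ->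
    measurable_fun setT ((p \o F) \o row_) by exact: continuous_measurable_row.
have h1 := cvg_sum_tiles (mf _ c1) (decaying_integrable dF (@cmod_Re R) c1).
have h2 := cvg_sum_tiles (mf _ c2) (decaying_integrable dF (@cmod_Im R) c2).
have e2 : 0 < e / 2 by rewrite divr_gt0.
move/cvgrPdist_le : h1 => /(_ _ e2)[m1 _ h1].
move/cvgrPdist_le : h2 => /(_ _ e2)[m2 _ h2].
exists (maxn m1 m2) => m; rewrite geq_max => /andP[mm1 mm2].
rewrite [leRHS](_ : _ = e / 2 + e / 2); last by field.
apply: cmod_ge_parts.
  by rewrite Re_add Re_opp Re_sum /= preimage_setT; exact: h1.
by rewrite Im_add Im_opp Im_sum /= preimage_setT; exact: h2.
Qed.

Lemma schwartz_decaying f : schwartz f -> decaying f.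
Proof.
move=> sf; split; first exact/smooth_continuous/schwartz_smooth.
have [A A0 hA] := schwartz_shift_bound sf.
(* The product bounds [growth x] on the cube, where the coordinates are at most 2 pi. *)
exists (A * \prod_(i < n) (6 * (1 + (2 * pi) ^+ 2))) => x k cx.
rewrite (le_trans (hA x x k _))//; first by move=> i; rewrite subrr normr0.
rewrite ler_wpM2r ?(ltW (weight_gt0 _ _))// ler_wpM2l// ler_prod// => i _.
rewrite mulr_ge0 ?addr_ge0 ?sqr_ge0//= ler_wpM2l// lerD2l.
have /andP[h0 h1] := cx i.
by rewrite lerXn2r ?nnegrE ?(ltW h1)// (le_trans h0 (ltW h1)).
Qed.

Lemma periodization_cbounded f : schwartz f -> cbounded (periodization f).
Proof.
move=> /periodization_smooth tg; split.
  exact/smooth_continuous/tg.1.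
by have [M _ hM] := smooth_torus_bounded tg; exists M.
Qed.

Lemma periodization_cube_approx f : schwartz f -> forall e : R, 0 < e ->
  exists m, forall m', (m <= m')%N -> forall x, cube x ->
  cmod (periodization f x - \sum_(k <- box n m') f (x + per k)) <= e.
Proof.
move=> /schwartz_decaying[_ [A hA]] e e0.
have A1 : 0 < `|A| + 1 by rewrite ltr_wpDl.
have e1 : 0 < e / (`|A| + 1) by rewrite divr_gt0.
have [m hm] := @sumZ_approx R n _ e1; exists m => m' mm' x cx.
rewrite (le_trans (hm _ `|A| _ _ _)) ?box_subset//.
  by move=> k; rewrite (le_trans (hA _ _ cx))// ler_wpM2r ?ler_norm// ltW ?weight_gt0.
by rewrite mulrCA ger_pMr// ler_pdivrMr ?mul1r ?lerDl.
Qed.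

(** The infinite sum is never exchanged with the integral: on the cube it is within e / (2 pi)^n of
    a finite box sum, which costs e after integration, and the triangle inequality for the finite
    sum gives the integral of |f| over finitely many tiles. *)
Lemma L1norm_periodization f : schwartz f ->
  (L1norm (@cube R n) (periodization f) <= L1norm setT f)%E.
Proof.
move=> sf; have [cf _] := schwartz_decaying sf.
have mC := @measurable_cube R n.
have cP := (periodization_cbounded sf).1.
apply/lee_addgt0Pr => e e0.
have p0 : 0 < (2 * pi) ^+ n :> R by rewrite exprn_gt0// mulr_gt0// pi_gt0.
have e1 : 0 < e / (2 * pi) ^+ n by rewrite divr_gt0.
have [m hm] := periodization_cube_approx sf e1.
have mfk k : measurable_fun cube_ (fun t => (cmod (f (row_ t + per k)))%:E).
  apply: measurable_funTS; apply/measurable_EFinP.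
  exact: (measurable_cmod (ccontinuous_shift (per k) cf)).
apply: (@le_trans _ _ (\int[mu]_(t in cube_)
    ((\sum_(k <- box n m) (cmod (f (row_ t + per k)))%:E) +
      (e / (2 * pi) ^+ n)%:E))%E).
  apply: ge0_le_integral => //.
  - by move=> t _; rewrite lee_fin cmod_ge0.
  - by apply: measurable_funTS; apply/measurable_EFinP; exact: measurable_cmod.
  - apply: emeasurable_funD => //; exact: emeasurable_sum.
  - move=> t ct; rewrite sumEFin -EFinD lee_fin.
    rewrite -[X in cmod X](subrK (\sum_(k <- box n m) f (row_ t + per k))).
    rewrite (le_trans (cmodD _ _))// addrC lerD ?cmod_sum//.
    exact: hm.
rewrite ge0_integralD//; first last.
- by move=> t _; rewrite lee_fin ltW.
- exact: emeasurable_sum.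
- by move=> t _; apply: sume_ge0 => k _; rewrite lee_fin cmod_ge0.
rewrite integral_cst// [X in (_ + _ * X)%E](_ : _ = ((2 * pi) ^+ n)%:E);
  last exact: lebesgue_cube.
rewrite -EFinM divfK ?gt_eqF// leeD2r//.
rewrite ge0_integral_sum//; last by move=> k t _; rewrite lee_fin cmod_ge0.
rewrite -(@ge0_integral_tiles _ _ (box n m) (fun x => cmod (f x))); first last.
- by move=> x; exact: cmod_ge0.
- exact: measurable_cmod.
rewrite /L1norm preimage_setT; apply: ge0_subset_integral => //.
- exact: measurable_tiles.
- by apply/measurable_EFinP; exact: measurable_cmod.
- by move=> t _; rewrite lee_fin cmod_ge0.
Qed.

End integrals_over_space.

(** * Characters of the torus and elementary properties of Fourier coefficients *)

Section characters.
Context (R : realType) (n : nat).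
Local Notation C := R[i].
Local Notation Rn := 'rV[R]_n.
Local Notation Zn := 'rV[int]_n.
Local Notation per k := ((2 * pi) *: ZnR R k).
Local Notation e_ i := (delta_mx 0 i : Rn).
Implicit Types (x y v : Rn) (k l : Zn) (F G f g : Rn -> C) (j : 'I_n).

Definition echar k x : C := expi (dotp x (ZnR R k)).

Lemma dotpDl x y v : dotp (x + y) v = dotp x v + dotp y v.
Proof.
by rewrite /dotp -big_split/=; apply: eq_bigr => i _; rewrite mxE mulrDl.
Qed.

Lemma dotpDr x y v : dotp v (x + y) = dotp v x + dotp v y.
Proof.
by rewrite /dotp -big_split/=; apply: eq_bigr => i _; rewrite mxE mulrDr.
Qed.

Lemma dotpZl (a : R) x v : dotp (a *: x) v = a * dotp x v.
Proof.
by rewrite /dotp mulr_sumr; apply: eq_bigr => i _; rewrite mxE mulrA.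
Qed.

Lemma dotp_delta j v : dotp (e_ j) v = v 0 j.
Proof.
rewrite /dotp (bigD1 j)//= mxE !eqxx mul1r big1 ?addr0// => i /negbTE ij.
by rewrite mxE ij mul0r.
Qed.

Lemma echarD k l x : echar (k + l) x = echar k x * echar l x.
Proof. by rewrite /echar ZnRD dotpDr expiD. Qed.

Lemma echar0 x : echar 0 x = 1.
Proof.
rewrite /echar ZnR0 /dotp big1 ?expi0// => i _.
by rewrite mxE mulr0.
Qed.

Lemma echar_shift k x y : echar k (x + y) = echar k x * echar k y.
Proof. by rewrite /echar dotpDl expiD. Qed.

Lemma cmod_echar k x : cmod (echar k x) = 1.
Proof. exact: cmod_expi. Qed.

Lemma expiN_dotp x k : expi (- dotp x (ZnR R k)) = echar (- k) x.
Proof.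
rewrite /echar ZnRN /dotp -sumrN; congr expi; apply: eq_bigr => i _.
by rewrite [in RHS]mxE mulrN.
Qed.

Lemma conj_echar k x : conjc (echar k x) = echar (- k) x.
Proof. by rewrite -expiN_dotp expiN. Qed.

Lemma echar_line k x (t : R) j :
  echar k (x + t *: e_ j) = expi (t * (k 0 j)%:~R) * echar k x.
Proof. by rewrite echar_shift mulrC /echar dotpZl dotp_delta ZnRE. Qed.

Lemma echar_periodic k x l : echar k (x + per l) = echar k x.
Proof.
rewrite echar_shift [X in _ * X](_ : _ = 1) ?mulr1// /echar.
rewrite (_ : dotp _ _ = (\sum_i l 0 i * k 0 i)%:~R * (2 * pi)).
  exact: expi_period.
rewrite dotpZl mulrC; congr (_ * _); rewrite /dotp rmorph_sum/=.
by apply: eq_bigr => i _; rewrite !ZnRE rmorphM.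
Qed.

Lemma echar_ccontinuous k : ccontinuous (echar k).
Proof.
have c : continuous (fun x : Rn => dotp x (ZnR R k)).
  rewrite /dotp; elim: (index_enum _) => [|i r IH] x.
    by under eq_fun do rewrite big_nil; exact: cst_continuous.
  under eq_fun do rewrite big_cons.
  apply: (@continuousD _ _ _ (fun y : Rn => y 0 i * ZnR R k 0 i)); last exact: IH.
  apply: (@continuousM _ _ (fun y : Rn => y 0 i)); last exact: cst_continuous.
  exact: coord_continuous.
split => x.
  exact: (continuous_comp (c x) (@continuous_cos R _)).
exact: (continuous_comp (c x) (@continuous_sin R _)).
Qed.

Lemma echar_cbounded k : cbounded (echar k).
Proof.
split; first exact: echar_ccontinuous.
by exists 1 => x; rewrite cmod_echar.
Qed.

Local Notation c0 := (((2 * pi) ^- n)%:C : C).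

Lemma fourierTE g k : fourierT g k =
  cintegral (@cube R n) (fun x => echar (- k) x * g x * c0).
Proof. by congr cintegral; apply/funext => x; rewrite expiN_dotp. Qed.

Lemma fourierT_integrand_cbounded g k : cbounded g ->
  cbounded (fun x => echar (- k) x * g x * c0).
Proof.
move=> cg; apply: cboundedM; last exact: cbounded_cst.
by apply: cboundedM => //; exact: echar_cbounded.
Qed.

Let p0 : 0 < (2 * pi) ^+ n :> R.
Proof. by rewrite exprn_gt0// mulr_gt0// pi_gt0. Qed.

Lemma cmod_fourierT_le g k (M : R) : cbounded g ->
  (forall x, cube x -> cmod (g x) <= M) -> cmod (fourierT g k) <= 2 * M.
Proof.
move=> cg hM; rewrite fourierTE.
have h x : cube x -> cmod (echar (- k) x * g x * c0) <= M * (2 * pi) ^- n.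
  move=> cx; rewrite !cmodM cmod_echar mul1r cmodR ger0_norm ?invr_ge0 ?(ltW p0)//.
  by rewrite ler_wpM2r ?invr_ge0 ?(ltW p0)// hM.
rewrite (le_trans (cmod_cintegral_le_cst (fourierT_integrand_cbounded k cg) h))//.
by rewrite -!mulrA mulVf ?mulr1// gt_eqF.
Qed.

Lemma fourierTD f g k : cbounded f -> cbounded g ->
  fourierT (fun x => f x + g x) k = fourierT f k + fourierT g k.
Proof.
move=> cf cg; rewrite !fourierTE -cintegralD; [|exact: fourierT_integrand_cbounded..].
by congr cintegral; apply/funext => x; rewrite mulrDr mulrDl.
Qed.

Lemma fourierTZ (c : C) g k : cbounded g ->
  fourierT (fun x => c * g x) k = c * fourierT g k.
Proof.
move=> cg; rewrite !fourierTE -cintegralZ; last exact: fourierT_integrand_cbounded.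
by congr cintegral; apply/funext => x; rewrite mulrCA -!mulrA.
Qed.

Lemma fourierTB f g k : cbounded f -> cbounded g ->
  fourierT (fun x => f x - g x) k = fourierT f k - fourierT g k.
Proof.
move=> cf cg; rewrite -[X in _ = _ + X]mulN1r -fourierTZ// -fourierTD//.
  by congr fourierT; apply/funext => x; rewrite mulN1r.
exact: cboundedZ.
Qed.

Lemma fourierT_sum (I : Type) (r : seq I) (F : I -> Rn -> C) k :
  (forall i, cbounded (F i)) ->
  fourierT (fun x => \sum_(i <- r) F i x) k = \sum_(i <- r) fourierT (F i) k.
Proof.
move=> cF; elim: r => [|i r IH].
  rewrite big_nil fourierTE; under eq_fun do rewrite big_nil mulr0 mul0r.
  exact: cintegral0.
rewrite big_cons -IH -fourierTD//; last exact: cbounded_sum.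
by congr fourierT; apply/funext => x; rewrite big_cons.
Qed.

(** If k_j is nonzero, translating by pi / |k_j| in direction j multiplies the character by -1 while
    preserving its integral, which therefore vanishes. *)
Lemma cintegral_echar k :
  cintegral (@cube R n) (echar k) = ((k == 0)%:R * (2 * pi) ^+ n)%:C.
Proof.
case: eqVneq => [->|k0].
  rewrite mul1r (_ : echar 0 = fun=> 1); first by rewrite cintegral_cst mul1r.
  by apply/funext => x; rewrite echar0.
have [j kj] : exists j, k 0 j != 0.
  apply/existsP; apply: contraNT k0; rewrite negb_exists => /forallP h.
  by apply/eqP/rowP => i; rewrite mxE; have := h i; rewrite negbK => /eqP.
have a1 : 1 <= `|(k 0 j)%:~R| :> R.
  by rewrite -intr_norm -[1]/(1%:~R) ler_int -gtz0_ge1 normr_gt0.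
have t02 : 0 <= (pi / `|(k 0 j)%:~R| : R) < 2 * pi.
  have pi0 := pi_gt0 R; apply/andP; split; first by rewrite divr_ge0// ltW.
  rewrite ltr_pdivrMr; last by rewrite (lt_le_trans _ a1).
  nra.
have e1 : expi (pi / `|(k 0 j)%:~R| * (k 0 j)%:~R) = -1 :> C.
  have kj' : (k 0 j)%:~R != 0 :> R by rewrite intr_eq0.
  case: (ltP 0 ((k 0 j)%:~R : R)) => hk.
    by rewrite gtr0_norm// divfK// expi_pi.
  rewrite ler0_norm// invrN mulrN mulNr divfK// expiN expi_pi.
  by apply: complexP; rewrite /= ?oppr0.
have := cintegral_shift j (echar_cbounded k) (echar_periodic k) t02.
under eq_fun do rewrite echar_line e1.
rewrite cintegralZ; last exact: echar_cbounded.
move=> h; rewrite mul0r.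
have : cintegral (@cube R n) (echar k) *+ 2 = 0.
  by rewrite mulr2n -{1}h mulN1r addNr.
by move/eqP; rewrite mulrn_eq0/= => /eqP.
Qed.

Lemma fourierT_echar k l : fourierT (echar l) k = (l == k)%:R.
Proof.
rewrite fourierTE.
under eq_fun do rewrite -echarD mulrC.
rewrite cintegralZ; last exact: echar_cbounded.
rewrite cintegral_echar addrC subr_eq0 -rmorphM/= mulrCA mulVf ?gt_eqF// mulr1.
by rewrite rmorph_nat.
Qed.

(* Summing over the translates of the fundamental cube turns the integral of f
   over R^n into the integral of its periodization over the cube, the characters
   being periodic. *)
Lemma fourierT_periodization f k : schwartz f ->
  fourierT (periodization f) k = fourierR f (ZnR R k).
Proof.
move=> sf; apply: eq_cmod_small => e e0.
have [cf [A hA]] := schwartz_decaying sf.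
pose G x := echar (- k) x * f x * c0.
have GE : fourierR f (ZnR R k) = cintegral setT G.
  by congr cintegral; apply/funext => x; rewrite expiN_dotp.
have dG : decaying G.
  split.
    apply: ccontinuousM; last exact: ccontinuous_cst.
    by apply: ccontinuousM => //; exact: echar_ccontinuous.
  exists (A * (2 * pi) ^- n) => x l cx.
  rewrite !cmodM cmod_echar mul1r cmodR ger0_norm ?invr_ge0 ?(ltW p0)//.
  by rewrite mulrAC ler_wpM2r ?invr_ge0 ?(ltW p0)// hA.
have e2 : 0 < e / 2 by rewrite divr_gt0.
have e4 : 0 < e / 4 by rewrite divr_gt0.
have [m1 h1] := cintegral_setT_approx dG e2.
have [m2 h2] := periodization_cube_approx sf e4.
pose m := maxn m1 m2.
have bf l : cbounded (fun x => f (x + per l)).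
  by apply: cbounded_shift; exact/decaying_cbounded/schwartz_decaying.
have E : \sum_(l <- box n m) cintegral (@cube R n) (fun x => G (x + per l)) =
    fourierT (fun x => \sum_(l <- box n m) f (x + per l)) k.
  rewrite fourierT_sum//; apply: eq_bigr => l _; rewrite fourierTE.
  by congr cintegral; apply/funext => x; rewrite /G echar_periodic.
rewrite (le_trans (cmod_dist_triangle _
  (fourierT (fun x => \sum_(l <- box n m) f (x + per l)) k) _))//.
rewrite [leRHS](_ : _ = e / 2 + e / 2); last by field.
rewrite lerD//; last first.
  by rewrite GE cmodBC -E h1// leq_maxl.
rewrite -fourierTB; [|exact: periodization_cbounded|exact: cbounded_sum].
rewrite (_ : e / 2 = 2 * (e / 4)); last by field.
apply: cmod_fourierT_le => [|x cx]; last by apply: h2 => //; exact: leq_maxr.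
exact: (cboundedB (periodization_cbounded sf) (cbounded_sum (box n m) bf)).
Qed.

End characters.

(** * Decay, uniqueness and inversion *)

Section fourier_decay.
Context (R : realType) (n : nat).
Local Notation C := R[i].
Local Notation Rn := 'rV[R]_n.
Local Notation Zn := 'rV[int]_n.
Local Notation per k := ((2 * pi) *: ZnR R k).
Local Notation e_ i := (delta_mx 0 i : Rn).
Implicit Types (x y v : Rn) (k l : Zn) (F G f g : Rn -> C) (j : 'I_n).

Lemma smooth_torus_cbounded g : smooth_torus g -> cbounded g.
Proof.
move=> tg; split; first exact/smooth_continuous/tg.1.
by have [M _ hM] := smooth_torus_bounded tg; exists M.
Qed.

(** This covariance under translation does the work of integration by parts: its derivative at t = 0
    is the formula for the coefficients of a partial derivative. *)
Lemma fourierT_shift g k j (t : R) : cbounded g ->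
  (forall x l, g (x + per l) = g x) -> 0 <= t < 2 * pi ->
  fourierT (fun x => g (x + t *: e_ j)) k = expi (t * (k 0 j)%:~R) * fourierT g k.
Proof.
move=> cg pg t02; rewrite !fourierTE.
have cG := fourierT_integrand_cbounded k cg.
rewrite -(cintegral_shift j cG _ t02); last first.
  by move=> x l; rewrite echar_periodic pg.
rewrite -cintegralZ; last exact: (cbounded_shift (t *: e_ j) cG).
congr cintegral; apply/funext => x.
rewrite echar_line [(- k) 0 j]mxE mulrNz mulrN !mulrA expiK mul1r //.
Qed.

Lemma expi_taylor2 (s : R) : cmod (expi s - 1 - s%:C * 'i) <= 2 * s ^+ 2.
Proof.
rewrite (mulr_natl _ 2) mulr2n; apply: cmod_ge_parts.
  have := @taylor2_abs R cos (fun u : R => - sin u) (fun u : R => - cos u) s 1.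
  rewrite cos0 sin0 oppr0 mulr0 mul1r.
  rewrite !Re_add !Re_opp Re_mul/= !mulr0 mul0r !subr0; apply => u _.
  by rewrite normrN ler_norml cos_geN1 cos_le1.
have := @taylor2_abs R sin cos (fun u : R => - sin u) s 1.
rewrite cos0 sin0 mulr1 mul1r subr0.
rewrite !Im_add !Im_opp Im_mul/= mulr1 mul0r addr0 subr0; apply => u _.
by rewrite normrN ler_norml sin_geN1 sin_le1.
Qed.

(* The coefficients of the difference quotients of g in direction j are those
   of g multiplied by (e^{it k_j} - 1)/t; both sides converge as t -> 0. *)
Lemma fourierT_partial g k j : smooth_torus g ->
  fourierT (partial j g) k = (k 0 j)%:~R%:C * 'i * fourierT g k.
Proof.
move=> tg; have tg1 := smooth_torus_partial j tg.
have tg2 := smooth_torus_partial j tg1.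
have [M M0 hM] := smooth_torus_bounded tg2.
have cg := smooth_torus_cbounded tg; have cg1 := smooth_torus_cbounded tg1.
set a : R := (k 0 j)%:~R; set w := fourierT g k; set w1 := fourierT _ k.
(* [4 * M] is the Taylor bound [2 * M] doubled by [cmod_fourierT_le]; the other term is the
   remainder of exp(i t a) from [expi_taylor2], times |w|. *)
pose K := 4 * M + 2 * a ^+ 2 * cmod w.
have K0 : 0 <= K.
  apply: addr_ge0; first exact: mulr_ge0.
  by apply: mulr_ge0; [apply: mulr_ge0 => //; exact: sqr_ge0|exact: cmod_ge0].
have key (t : R) : 0 < t <= 1 -> cmod (w1 - a%:C * 'i * w) <= K * t.
  move=> /andP[t0 t1].
  have t02 : 0 <= t < 2 * pi.
    by rewrite ltW//=; have := pi_ge1 R; lra.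
  have h1 : cmod ((expi (t * a) - 1) * w - t%:C * w1) <= 4 * M * t ^+ 2.
    have cs := cbounded_shift (t *: e_ j) cg.
    rewrite mulrBl mul1r -(fourierT_shift _ _ cg tg.2 t02) -fourierTB//.
    rewrite -fourierTZ// -fourierTB//; last 2 first.
    - exact: (cboundedB cs cg).
    - exact: cboundedZ.
    rewrite (_ : 4 * M * t ^+ 2 = 2 * (2 * M * t ^+ 2)); last by ring.
    apply: cmod_fourierT_le.
      exact: (cboundedB (cboundedB cs cg) (cboundedZ t%:C cg1)).
    by move=> x _; apply: smooth_taylor2; [exact: tg.1|move=> s _; exact: hM].
  have h2 : cmod ((expi (t * a) - 1 - (t * a)%:C * 'i) * w) <=
      2 * a ^+ 2 * cmod w * t ^+ 2.
    rewrite cmodM (le_trans (ler_wpM2r (cmod_ge0 _) (expi_taylor2 _)))//.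
    by rewrite exprMn le_eqVlt; apply/orP; left; apply/eqP; ring.
  have h3 : t * cmod (w1 - a%:C * 'i * w) <= t * (K * t).
    rewrite (_ : t * cmod _ = cmod (t%:C * (w1 - a%:C * 'i * w))); last first.
      by rewrite cmodM cmodR gtr0_norm.
    rewrite (_ : t%:C * _ = (expi (t * a) - 1 - (t * a)%:C * 'i) * w -
      ((expi (t * a) - 1) * w - t%:C * w1)); last by rewrite rmorphM/=; ring.
    rewrite (le_trans (cmodB _ _))// (le_trans (lerD h2 h1))//.
    by rewrite le_eqVlt; apply/orP; left; apply/eqP; rewrite /K; ring.
  by rewrite -(ler_pM2l t0).
apply: eq_cmod_small => e e0.
have K1 : 0 < K + 1 by rewrite ltr_wpDl.
pose t := Num.min 1 (e / (K + 1)).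
have t0 : 0 < t by rewrite lt_min ltr01 divr_gt0.
rewrite (le_trans (key t _))//; first by rewrite t0 ge_min lexx.
rewrite (@le_trans _ _ (K * (e / (K + 1))))//.
  by rewrite ler_wpM2l// ge_min lexx orbT.
by rewrite mulrCA ger_pMr// ler_pdivrMr ?mul1r ?lerDl.
Qed.

Lemma dotpp_ge0 x : 0 <= dotp x x.
Proof. by apply: sumr_ge0 => i _; rewrite -expr2 sqr_ge0. Qed.

Lemma japanese_sq x : japanese x ^+ 2 = 1 + dotp x x.
Proof. by rewrite sqr_sqrtr// addr_ge0// dotpp_ge0. Qed.

Lemma japanese_ge0 x : 0 <= japanese x.
Proof. exact: sqrtr_ge0. Qed.

Lemma japanese_le x : japanese x <= 1 + \sum_i `|x 0 i|.
Proof.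
have s0 : 0 <= \sum_i `|x 0 i| by apply: sumr_ge0.
rewrite -[leRHS]ger0_norm ?addr_ge0// -sqrtr_sqr ler_wsqrtr//.
rewrite sqrrD expr1n mul1r; suff : dotp x x <= (\sum_i `|x 0 i|) ^+ 2 by lra.
rewrite expr2 mulr_sumr; apply: ler_sum => i _.
rewrite -expr2 -real_normK ?num_real// expr2 ler_wpM2r//.
by rewrite (bigD1 i)//= lerDl; apply: sumr_ge0.
Qed.

(** Induction on N for all g at once: one factor [japanese] is at most 1 plus the sum of the |k_j|,
    and each |k_j| is traded for a partial derivative of g. *)
Lemma fourierT_schwartzZ g : smooth_torus g -> schwartzZ (fourierT g).
Proof.
move=> tg N; elim: N g tg => [|N IH] g tg.
  have [M M0 hM] := smooth_torus_bounded tg.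
  exists (2 * M) => k; rewrite expr0 mul1r; apply: cmod_fourierT_le => //.
  exact: smooth_torus_cbounded.
have [M0 h0] := IH _ tg.
have /choice[M hM] : forall j, exists M : R, forall k,
    japanese (ZnR R k) ^+ N * cmod (fourierT (partial j g) k) <= M.
  by move=> j; apply: IH; exact: smooth_torus_partial.
exists (M0 + \sum_j M j) => k.
rewrite exprS -mulrA (le_trans (ler_wpM2r _ (japanese_le _)))//.
  by rewrite mulr_ge0 ?exprn_ge0 ?japanese_ge0 ?cmod_ge0.
rewrite mulrDl mul1r lerD// mulr_suml; apply: ler_sum => j _.
rewrite (le_trans _ (hM j k))// mulrCA fourierT_partial// !cmodM cmodR -ZnRE.
rewrite ler_wpM2l ?exprn_ge0 ?japanese_ge0// le_eqVlt; apply/orP; left.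
rewrite (_ : cmod 'i = 1) ?mulr1//.
by rewrite /cmod /= expr0n expr1n add0r sqrtr1.
Qed.

Lemma schwartzZ_wbounded (h : Zn -> C) : schwartzZ h -> wbounded h.
Proof.
(* The exponent 2n is the one for which the power of [japanese] is (1 + |k|^2)^n, a bound for the
   product of the n factors 1 + k_i^2. *)
move=> /(_ (2 * n)%N)[M hM]; exists M => k.
have p0 : 0 < \prod_i (1 + ((k 0 i)%:~R : R) ^+ 2).
  by apply: prodr_gt0 => i _; rewrite ltr_pwDl// sqr_ge0.
rewrite /weight prodfV ler_pdivlMr// mulrC (le_trans _ (hM k))//.
rewrite ler_wpM2r ?cmod_ge0// exprM japanese_sq.
rewrite -[X in _ <= _ ^+ X]card_ord -prodr_const; apply: ler_prod => i _.
rewrite addr_ge0 ?sqr_ge0//= lerD2l /dotp (bigD1 i)//= ZnRE -expr2 lerDl.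
by apply: sumr_ge0 => j _; rewrite -expr2 sqr_ge0.
Qed.

Lemma echarM_wbounded (h : Zn -> C) x : wbounded h ->
  wbounded (fun k => echar k x * h k).
Proof. by move=> [A hA]; exists A => k; rewrite cmodM cmod_echar mul1r. Qed.

End fourier_decay.

(** * The Fejer kernel and uniqueness of Fourier coefficients *)

Section fourier_uniqueness.
Context (R : realType) (n : nat).
Local Notation C := R[i].
Local Notation Rn := 'rV[R]_n.
Local Notation Zn := 'rV[int]_n.
Local Notation per k := ((2 * pi) *: ZnR R k).
Local Notation e_ i := (delta_mx 0 i : Rn).
Implicit Types (x y v : Rn) (k l : Zn) (F G f g d : Rn -> C) (j : 'I_n).

Definition freq N (f : {ffun 'I_n -> 'I_N}) : Zn := \row_i (f i)%:Z.

Lemma freq_inj N : injective (@freq N).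
Proof.
move=> f g /rowP fg; apply/ffunP => i; have := fg i; rewrite !mxE.
by move=> [] /val_inj.
Qed.

(** The unnormalised kernel: N^n times the product of the one-dimensional Fejer kernels. As a
    squared modulus it is visibly nonnegative, and its frequencies may start at 0 since a phase does
    not affect the modulus. *)
Definition fejer N x : R :=
  cmod (\sum_(f : {ffun 'I_n -> 'I_N}) echar (freq f) x) ^+ 2.

Lemma fejerE N x : (fejer N x)%:C =
  \sum_(f : {ffun 'I_n -> 'I_N}) \sum_(g : {ffun 'I_n -> 'I_N})
    echar (freq f - freq g) x.
Proof.
rewrite /fejer rmorphXn/= cmodE sqr_normc [X in _ * X]rmorph_sum mulr_suml.
apply: eq_bigr => f _; rewrite mulr_sumr; apply: eq_bigr => g _.
by rewrite echarD -conj_echar.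
Qed.

Lemma fejer_ge0 N x : 0 <= fejer N x. Proof. exact: sqr_ge0. Qed.

Lemma echar_shift_cbounded k v : cbounded (fun x => echar k (x + v) : C).
Proof. exact/cbounded_shift/echar_cbounded. Qed.

Lemma fejer_cbounded N v : cbounded (fun x => (fejer N (x + v))%:C).
Proof.
under eq_fun do rewrite fejerE.
by apply: cbounded_sum => f; apply: cbounded_sum => g; exact: echar_shift_cbounded.
Qed.

Lemma cintegralM_fejer F N v : cbounded F ->
  cintegral (@cube R n) (fun x => F x * (fejer N (x + v))%:C) =
  \sum_(f : {ffun 'I_n -> 'I_N}) \sum_(g : {ffun 'I_n -> 'I_N})
    echar (freq f - freq g) v *
    cintegral (@cube R n) (fun x => F x * echar (freq f - freq g) x).
Proof.
move=> cF.
have cFe k : cbounded (fun x => F x * echar k x).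
  by apply: cboundedM => //; exact: echar_cbounded.
under eq_fun => x.
  rewrite fejerE mulr_sumr.
  under eq_bigr => f _ do
    (rewrite mulr_sumr; under eq_bigr => g _ do rewrite echar_shift mulrA mulrC).
  over.
rewrite cintegral_sum; last first.
  by move=> f; apply: cbounded_sum => g; exact: cboundedZ.
apply: eq_bigr => f _; rewrite cintegral_sum; last by move=> g; exact: cboundedZ.
by apply: eq_bigr => g _; rewrite cintegralZ.
Qed.

Let P : R := (2 * pi) ^+ n.

Let P0 : 0 < P.
Proof. by rewrite exprn_gt0// mulr_gt0// pi_gt0. Qed.

Lemma cintegral_fejer N v :
  cintegral (@cube R n) (fun x => (fejer N (x + v))%:C) = (P * (N ^ n)%:R)%:C.
Proof.
have := cintegralM_fejer N v (cbounded_cst n (1 : C)).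
under eq_fun do rewrite mul1r.
move=> ->; under eq_bigr => f _.
  rewrite (bigD1 f)//= subrr echar0 mul1r big1 => [|g gf].
    rewrite addr0; under eq_fun do rewrite mul1r.
    by rewrite cintegral_echar eqxx mul1r; over.
  under eq_fun do rewrite mul1r.
  rewrite cintegral_echar subr_eq0; case: eqP => [/freq_inj fg|_].
    by rewrite fg eqxx in gf.
  by rewrite mul0r mulr0.
rewrite sumr_const card_ffun !card_ord -rmorphMn/=.
by rewrite mulr_natr.
Qed.

(** Counts the frequencies that can be raised by one in coordinate j without leaving the range; each
    will contribute a unit to the cosine moment of the kernel. *)
Lemma card_ffun_lt M j :
  \sum_(f : {ffun 'I_n -> 'I_M.+1}) ((f j).+1 < M.+1)%:R =
  (M.+1 ^ n)%:R * (1 - M.+1%:R^-1) :> R.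
Proof.
pose G i (a : 'I_M.+1) : R := if i == j then (a.+1 < M.+1)%:R else 1.
transitivity (\sum_(f : {ffun 'I_n -> 'I_M.+1}) \prod_i G i (f i)).
  apply: eq_bigr => f _; rewrite (bigD1 j)//= /G eqxx big1 ?mulr1// => i.
  by move=> /negbTE ->.
rewrite -(bigA_distr_bigA G)/= natrX -[X in _ ^+ X]card_ord -prodr_const.
rewrite (bigD1 j)//= [in RHS](bigD1 j)//= mulrAC; congr (_ * _).
  rewrite /G eqxx big_ord_recr/= ltnn addr0.
  under eq_bigr => i _ do rewrite ltnS ltn_ord.
  rewrite sumr_const card_ord mulrBr mulr1 mulfV ?pnatr_eq0//.
  by rewrite -natr1 addrK.
apply: eq_bigr => i /negbTE ij; rewrite /G ij sumr_const card_ord.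
by [].
Qed.

(** By orthogonality the integral is [P] times the number of pairs (f, g) with g = f + e_j. It falls
    short of the total mass by a fraction of at most 1/(M + 1): the kernel concentrates at x0. *)
Lemma cintegral_echar_fejer M j x0 : exists c : R,
  cintegral (@cube R n) (fun x => echar (delta_mx 0 j) (x - x0) *
    (fejer M.+1 (x - x0))%:C) = c%:C /\
  P * (M.+1 ^ n)%:R * (1 - M.+1%:R^-1) <= c.
Proof.
pose k : Zn := delta_mx 0 j.
pose cnt : R := \sum_(f : {ffun 'I_n -> 'I_M.+1})
  \sum_(g : {ffun 'I_n -> 'I_M.+1}) (k + (freq f - freq g) == 0)%:R.
exists (cnt * P); split.
  rewrite cintegralM_fejer; last exact: echar_shift_cbounded.
  rewrite /cnt mulr_suml rmorph_sum/=; apply: eq_bigr => f _.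
  rewrite mulr_suml rmorph_sum/=; apply: eq_bigr => g _.
  under eq_fun do rewrite echar_shift mulrAC mulrC -echarD.
  rewrite cintegralZ; last exact: echar_cbounded.
  rewrite cintegral_echar mulrA -echarD addrC.
  by case: eqP => [->|_]; rewrite ?echar0 ?mul1r// !mul0r mulr0.
rewrite -mulrA -(card_ffun_lt M j) mulrC ler_wpM2r ?(ltW P0)//.
apply: ler_sum => f _; case: ltnP => [fM|_]; last by apply: sumr_ge0.
(* The unique partner of f: f raised by one in coordinate j. *)
pose g : {ffun 'I_n -> 'I_M.+1} := [ffun i => if i == j then Ordinal fM else f i].
rewrite (bigD1 g)//= (_ : (k + (freq f - freq g) == 0) = true).
  by rewrite lerDl; apply: sumr_ge0.
apply/eqP/rowP => i; rewrite !mxE eqxx ffunE/=; case: eqP => [->|_] /=.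
  by rewrite intS; ring.
by rewrite add0r subrr.
Qed.

Lemma cos_periodic_int (a : R) (z : int) : cos (a + 2 * pi * z%:~R) = cos a.
Proof.
have := congr1 (@complex.Re R) (expiD a (z%:~R * (2 * pi))).
by rewrite expi_period mulr1 /= mulrC.
Qed.

(** Modulo periods, x is either close to x0, where continuity gives e, or some coordinate is at
    least s away, where 1 - cos is at least 1 - cos s and the crude bound [2 * M] is absorbed into
    K. *)
Lemma korovkin_bound d x0 (e : R) : ccontinuous d ->
  (forall x k, d (x + per k) = d x) -> 0 < e ->
  exists2 K : R, 0 <= K & forall x,
    cmod (d x0 - d x) <= e + K * \sum_j (1 - cos ((x - x0) 0 j)).
Proof.
move=> [c1 c2] pd e0.
have [M M0 hM] := periodic_bounded (conj c1 c2) pd.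
have e2 : 0 < e / 2 by rewrite divr_gt0.
have /cvgrPdist_le/(_ _ e2) n1 :
  (@complex.Re R \o d) @ x0 --> (@complex.Re R \o d) x0 by exact: c1.
have /cvgrPdist_le/(_ _ e2) n2 :
  (@complex.Im R \o d) @ x0 --> (@complex.Im R \o d) x0 by exact: c2.
have /nbhs_ballP[r /= r0 hr] : nbhs x0 [set y | cmod (d x0 - d y) <= e].
  apply: filterS2 n1 n2 => y h1 h2 /=.
  rewrite [leRHS](_ : _ = e / 2 + e / 2); last by field.
  by apply: cmod_ge_parts; rewrite ?Re_add ?Re_opp ?Im_add ?Im_opp.
(* Capping at pi keeps the distances in the range where cos is decreasing. *)
pose s := Num.min r pi.
have s0 : 0 < s by rewrite lt_min r0 pi_gt0.
have spi : s <= pi by rewrite ge_min lexx orbT.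
have cs : cos s < 1.
  rewrite -cos0 ltr_cos// in_itv/= ?lexx ?pi_ge0//.
  by rewrite ltW.
pose K := 2 * M / (1 - cos s).
have K0 : 0 <= K by rewrite divr_ge0 ?mulr_ge0// subr_ge0 ltW.
have t0 (u : Rn) : 0 <= \sum_j (1 - cos (u 0 j)).
  by apply: sumr_ge0 => j _; rewrite subr_ge0 cos_le1.
exists K => // x.
(* Both sides are periodic in x, so x may be moved into the cube of half-side pi centred at x0. *)
have [k hk] := translate_to_cube (x0 - const_mx pi) x.
pose y := x - per k.
have -> : d x = d y by rewrite -(subrK (per k) x) pd.
have -> : \sum_j (1 - cos ((x - x0) 0 j)) = \sum_j (1 - cos ((y - x0) 0 j)).
  apply: eq_bigr => j _; rewrite -(cos_periodic_int ((y - x0) 0 j) (k 0 j)).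
  by congr (1 - cos _); rewrite /y !mxE; ring.
have ypi j : `|(y - x0) 0 j| <= pi.
  have := hk j; rewrite /y ler_norml !mxE => /andP[h1 h2].
  by apply/andP; split; lra.
have [near_|] := boolP [forall j, `|(y - x0) 0 j| < s].
  rewrite (@le_trans _ _ e)//; last by rewrite lerDl mulr_ge0.
  apply: hr; split => // i j; rewrite ord1 /ball/= distrC.
  have := forallP near_ j; rewrite !mxE => /lt_le_trans; apply.
  by rewrite ge_min lexx.
rewrite negb_forall => /existsP[j]; rewrite -leNgt => hj.
have cj : cos ((y - x0) 0 j) <= cos s.
  have -> : cos ((y - x0) 0 j) = cos `|(y - x0) 0 j|.
    by case: (leP 0 ((y - x0) 0 j)) => h; [rewrite ger0_norm|rewrite ltr0_norm// cosN].
  move: hj; rewrite le_eqVlt => /orP[/eqP <-//|hj].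
  by rewrite ltW// ltr_cos// in_itv/= ?normr_ge0 ?ypi// ltW.
rewrite (le_trans (cmodB _ _))// (@le_trans _ _ (2 * M))//.
  by rewrite (mulr_natl _ 2) mulr2n lerD.
have -> : 2 * M = K * (1 - cos s) by rewrite /K divfK// gt_eqF// subr_gt0.
rewrite (@le_trans _ _ (K * \sum_j (1 - cos ((y - x0) 0 j))))//; last first.
  by rewrite lerDr ltW.
rewrite ler_wpM2l// (bigD1 j)//= (@le_trans _ _ (1 - cos ((y - x0) 0 j)))//.
  by rewrite lerB.
by rewrite lerDl; apply: sumr_ge0 => i _; rewrite subr_ge0 cos_le1.
Qed.

Lemma Re_cintegral_congr F G : (forall x, complex.Re (F x) = complex.Re (G x)) ->
  complex.Re (cintegral (@cube R n) F) = complex.Re (cintegral (@cube R n) G).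
Proof. by move=> FG /=; apply: eq_Rintegral => t _. Qed.

(* d(x0) is the limit of the averages of d against the Fejer kernel centred at
   x0, which all vanish; the convergence only needs the moments of the kernel
   against 1 and cos (Korovkin). *)
Lemma fourierT_eq0 d : ccontinuous d -> (forall x k, d (x + per k) = d x) ->
  (forall k, fourierT d k = 0) -> forall x0, d x0 = 0.
Proof.
move=> cd pd d0 x0; apply: eq_cmod_small => e e0; rewrite subr0.
have bd : cbounded d by split => //; have [M _] := periodic_bounded cd pd; exists M.
have e4 : 0 < e / 4 by rewrite divr_gt0.
have [K K0 hK] := korovkin_bound x0 cd pd e4.
(* Ensures K n / (M + 1) <= e / 4. The final bound is 2 (e/4 + K n / (M + 1)), the 2 coming from
   [cmod_cintegral_le]. *)
pose M := Num.truncn (4 * K * n%:R / e).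
pose Q : R := P * (M.+1 ^ n)%:R.
have Q0 : 0 < Q by rewrite mulr_gt0// ltr0n expn_gt0.
have dk k : cintegral (@cube R n) (fun x => d x * echar k x) = 0.
  have := d0 (- k); rewrite fourierTE opprK.
  under eq_fun do rewrite mulrC.
  rewrite cintegralZ; last by apply: cboundedM => //; exact: echar_cbounded.
  move/eqP; rewrite mulf_eq0 => /orP[|/eqP h].
    by rewrite fmorph_eq0 invr_eq0 gt_eqF.
  by rewrite -h; congr cintegral; apply/funext => x; rewrite mulrC.
have fb := fejer_cbounded M.+1 (- x0).
have dF0 : cintegral (@cube R n) (fun x => d x * (fejer M.+1 (x - x0))%:C) = 0.
  rewrite cintegralM_fejer// big1// => f _; rewrite big1// => g _.
  by rewrite dk mulr0.
have dE : cintegral (@cube R n) (fun x => (d x0 - d x) * (fejer M.+1 (x - x0))%:C)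
    = d x0 * Q%:C.
  rewrite -(cintegral_fejer M.+1 (- x0)) -cintegralZ// -[RHS]subr0 -[X in _ - X]dF0.
  rewrite -cintegralB; [|exact: cboundedZ|exact: cboundedM].
  by congr cintegral; apply/funext => x; rewrite mulrBl.
pose w x := (e / 4 + K * \sum_j (1 - cos ((x - x0) 0 j))) * fejer M.+1 (x - x0).
(* [W] has the same real part as the majorant [w], with characters in place of cosines, so that its
   integral follows from the moments of the kernel. *)
pose W x : C := (e / 4)%:C * (fejer M.+1 (x - x0))%:C +
  K%:C * \sum_j ((fejer M.+1 (x - x0))%:C -
    echar (delta_mx 0 j) (x - x0) * (fejer M.+1 (x - x0))%:C).
have bef j : cbounded (fun x =>
    echar (delta_mx 0 j) (x - x0) * (fejer M.+1 (x - x0))%:C).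
  by apply: cboundedM => //; exact: echar_shift_cbounded.
have bsub j : cbounded (fun x => (fejer M.+1 (x - x0))%:C -
    echar (delta_mx 0 j) (x - x0) * (fejer M.+1 (x - x0))%:C).
  exact: (cboundedB fb (bef j)).
have Re_echar j u : complex.Re (echar (delta_mx 0 j) u : C) = cos (u 0 j).
  rewrite /echar (_ : ZnR R (delta_mx 0 j) = e_ j) /=; last first.
    by apply/rowP => i; rewrite !mxE; case: (_ && _).
  rewrite /dotp (bigD1 j)//= mxE !eqxx mulr1 big1 ?addr0// => i /negbTE ij.
  by rewrite mxE ij mulr0.
have ReW x : complex.Re (w x)%:C = complex.Re (W x).
  rewrite /W Re_add !Re_mul/= !mul0r !subr0 Re_sum /w mulrDl; congr (_ + _).
  rewrite -mulrA mulr_suml; congr (_ * _); apply: eq_bigr => j _.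
  by rewrite Re_add Re_opp Re_mul Re_echar/= mulr0 subr0 mulrBl mul1r.
have bw : cbounded (fun x => (w x)%:C).
  (* The cosine is half the sum of a character and its conjugate. *)
  have bcos j : cbounded (fun x => (cos ((x - x0) 0 j))%:C : C).
    have := cboundedD (echar_shift_cbounded (delta_mx 0 j) (- x0))
      (echar_shift_cbounded (- delta_mx 0 j) (- x0)).
    move=> /(cboundedZ (2^-1)%:C).
    rewrite (_ : (fun x => _) = (fun x => (cos ((x - x0) 0 j))%:C))//.
    apply/funext => x; rewrite -conj_echar -Re_echar; case: (echar _ _) => a b.
    by apply: complexP => /=; field.
  rewrite (_ : (fun x => _) = fun x => ((e / 4)%:C + K%:C *
      \sum_j (1 - (cos ((x - x0) 0 j))%:C)) * (fejer M.+1 (x - x0))%:C); last first.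
    apply/funext => x; rewrite /w (rmorphM (real_complex R)).
    rewrite (rmorphD (real_complex R)); congr ((_ + _) * _).
    rewrite (rmorphM (real_complex R)) (rmorph_sum (real_complex R)).
    congr (_ * _).
    by apply: eq_bigr => j _; rewrite (rmorphB (real_complex R)).
  apply: cboundedM => //; apply: cboundedD; first exact: cbounded_cst.
  apply: cboundedZ; apply: cbounded_sum => j.
  exact: (cboundedB (cbounded_cst n 1) (bcos j)).
have hw x : cube x -> cmod ((d x0 - d x) * (fejer M.+1 (x - x0))%:C) <= w x.
  move=> _; rewrite cmodM cmodR ger0_norm ?fejer_ge0//.
  by rewrite ler_wpM2r ?fejer_ge0.
have b1 : cbounded (fun x => (d x0 - d x) * (fejer M.+1 (x - x0))%:C).
  apply: cboundedM => //.
  exact: (cboundedB (cbounded_cst n (d x0)) bd).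
have := cmod_cintegral_le b1 bw hw.
rewrite dE (Re_cintegral_congr ReW) cmodM cmodR gtr0_norm//.
have -> : cintegral (@cube R n) W = (e / 4)%:C * Q%:C +
    K%:C * \sum_j (Q%:C - cintegral (@cube R n) (fun x =>
       echar (delta_mx 0 j) (x - x0) * (fejer M.+1 (x - x0))%:C)).
  rewrite /W cintegralD; [|exact: cboundedZ|by apply: cboundedZ; exact: cbounded_sum].
  rewrite cintegralZ// cintegral_fejer cintegralZ; last exact: cbounded_sum.
  congr (_ + _ * _); rewrite cintegral_sum//; apply: eq_bigr => j _.
  by rewrite cintegralB// cintegral_fejer.
rewrite Re_add !Re_mul/= !mul0r !subr0 Re_sum => h.
have h2 : \sum_j complex.Re (Q%:C - cintegral (@cube R n) (fun x =>
       echar (delta_mx 0 j) (x - x0) * (fejer M.+1 (x - x0))%:C)) <=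
    n%:R * (Q / M.+1%:R).
  rewrite mulr_natl -[X in _ *+ X]card_ord -sumr_const; apply: ler_sum => j _.
  have [c [-> hc]] := cintegral_echar_fejer M j x0.
  by rewrite /= lerBlDr -lerBlDl (le_trans _ hc)// -/Q mulrBr mulr1.
have h3 : K * n%:R / M.+1%:R <= e / 4.
  rewrite ler_pdivrMr// [leRHS]mulrC -ler_pdivrMr//.
  rewrite (_ : _ / (e / 4) = 4 * K * n%:R / e); last by field; exact: lt0r_neq0.
  exact/ltW/truncnS_gt.
rewrite -(ler_pM2r Q0) (le_trans h)//.
rewrite (@le_trans _ _ (2 * (e / 4 * Q + K * (n%:R * (Q / M.+1%:R)))))//.
  by rewrite ler_wpM2l// lerD2l ler_wpM2l.
rewrite (_ : K * _ = (K * n%:R / M.+1%:R) * Q); last by ring.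
rewrite -mulrDl mulrA ler_wpM2r ?(ltW Q0)//.
by move: h3; set z := K * _ / _; lra.
Qed.

End fourier_uniqueness.

(** * Injectivity of the coefficient map and Fourier inversion on the torus *)

Section fourier_inversion.
Context (R : realType) (n : nat).
Local Notation C := R[i].
Local Notation Rn := 'rV[R]_n.
Local Notation Zn := 'rV[int]_n.
Local Notation per k := ((2 * pi) *: ZnR R k).
Implicit Types (x y v : Rn) (k l : Zn) (f g d : Rn -> C).

Lemma fourierT_injective :
  {in @smooth_torus R n &, injective (@fourierT R n)}.
Proof.
move=> f g /set_mem tf /set_mem tg fg; apply/funext => x.
apply/eqP; rewrite -subr_eq0; apply/eqP.
have bf := smooth_torus_cbounded tf; have bg := smooth_torus_cbounded tg.
apply: (@fourierT_eq0 R n (fun x => f x - g x)).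
- exact: (cboundedB bf bg).1.
- by move=> y k; rewrite tf.2 tg.2.
- by move=> k; rewrite fourierTB// fg subrr.
Qed.

Lemma fourier_inversion g : smooth_torus g -> forall x,
  g x = sumZ (fun k => echar k x * fourierT g k).
Proof.
move=> tg; have bg := smooth_torus_cbounded tg.
have wg := schwartzZ_wbounded (fourierT_schwartzZ tg).
have [A A0 hA] := wbounded_ge0 wg.
pose S x := sumZ (fun k => echar k x * fourierT g k).
have hAx x k : cmod (echar k x * fourierT g k) <= A * weight R k.
  by rewrite cmodM cmod_echar mul1r.
have unif (e : R) : 0 < e -> exists m, forall x (J : {fset Zn}),
    (box n m `<=` J)%fset ->
    cmod (S x - \sum_(k <- J) echar k x * fourierT g k) <= e.
  move=> e0; have e1 : 0 < e / (A + 1) by rewrite divr_gt0// ltr_wpDl.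
  have [m hm] := @sumZ_approx R n _ e1; exists m => x J mJ.
  rewrite (le_trans (hm _ _ (hAx x) _ mJ))//.
  by rewrite mulrCA ger_pMr// ler_pdivrMr ?mul1r ?lerDl// ltr_wpDl.
have bT k : cbounded (fun x => echar k x * fourierT g k).
  by apply: cboundedM; [exact: echar_cbounded|exact: cbounded_cst].
have cS : ccontinuous S.
  apply: ccontinuous_uapprox => x e e0; have [m hm] := unif _ e0.
  exists (fun y => \sum_(k <- box n m) echar k y * fourierT g k).
    by apply: ccontinuous_sum => k; exact: (bT k).1.
  by apply: (@filterE _ _ (nbhs_filter x)) => y; exact: hm.
have pS x k : S (x + per k) = S x.
  by congr sumZ; apply/funext => l; rewrite echar_periodic.
have bS : cbounded S by split => //; have [M _] := periodic_bounded cS pS; exists M.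
move=> x; apply/eqP; rewrite -subr_eq0; apply/eqP.
apply: (@fourierT_eq0 R n (fun x => g x - S x)).
- exact: (cboundedB bg bS).1.
- by move=> y k; rewrite tg.2 pS.
move=> k; rewrite fourierTB//; apply/eqP; rewrite subr_eq0; apply/eqP/esym.
apply: eq_cmod_small => e e0; have e2 : 0 < e / 2 by rewrite divr_gt0.
have [m hm] := unif _ e2.
(* Adjoining k to the box makes the k-th coefficient of the finite sum exactly that of g, while the
   uniform error on [S] stays below e / 2. *)
pose J := (box n m `|` [fset k])%fset.
have kJ : k \in J by rewrite !inE eqxx orbT.
have -> : fourierT g k = fourierT (fun x => \sum_(l <- J) echar l x * fourierT g l) k.
  rewrite fourierT_sum// (big_fsetD1 k)//= big_seq big1 => [|l]; last first.
    rewrite !inE => /andP[lk _].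
    under eq_fun do rewrite mulrC.
    rewrite fourierTZ; last exact: echar_cbounded.
    by rewrite fourierT_echar (negbTE lk) mulr0.
  under eq_fun do rewrite mulrC.
  rewrite fourierTZ; last exact: echar_cbounded.
  by rewrite fourierT_echar eqxx mulr1 addr0.
rewrite -fourierTB//; last exact: cbounded_sum.
rewrite (_ : e = 2 * (e / 2)); last by field.
apply: cmod_fourierT_le => [|y _]; last by apply: hm; exact: fsubsetUl.
exact: (cboundedB bS (cbounded_sum J bT)).
Qed.

End fourier_inversion.

Theorem theorem6p2 (R : realType) (n : nat) (n_gt0 : (0 < n)%N) :
  (* the series defining the periodization converges (absolutely) *)
  (forall f : 'rV[R]_n -> R[i], schwartz f -> forall x : 'rV[R]_n,
     abs_summable (fun k : 'rV[int]_n => f (x + (2 * pi) *: ZnR R k))) /\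
  (* periodization maps S(R^n) to C^oo(T^n), surjectively *)
  set_fun (@schwartz R n) (@smooth_torus R n) (@periodization R n) /\
  set_surj (@schwartz R n) (@smooth_torus R n) (@periodization R n) /\
  (forall f : 'rV[R]_n -> R[i], schwartz f ->
     (L1norm (@cube R n) (periodization f) <= L1norm setT f)%E) /\
  (forall f : 'rV[R]_n -> R[i], schwartz f ->
     schwartzZ (fun xi : 'rV[int]_n => fourierR f (ZnR R xi)) /\
     forall x : 'rV[R]_n,
       periodization f x =
       fourierT_inv (fun xi : 'rV[int]_n => fourierR f (ZnR R xi)) x) /\
  (forall f : 'rV[R]_n -> R[i], schwartz f -> forall x : 'rV[R]_n,
     abs_summable (fun xi : 'rV[int]_n =>
       expi (dotp x (ZnR R xi)) * fourierR f (ZnR R xi)) /\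
     sumZ (fun k : 'rV[int]_n => f (x + (2 * pi) *: ZnR R k)) =
     sumZ (fun xi : 'rV[int]_n =>
       expi (dotp x (ZnR R xi)) * fourierR f (ZnR R xi))).
Proof.
(* With this identification, decay and summability of the transform at integer points, and both
   summation formulas, become statements about a smooth function on the torus. *)
have F f : schwartz f ->
    (fun xi : 'rV[int]_n => fourierR f (ZnR R xi)) = fourierT (periodization f).
  by move=> sf; apply/funext => k; rewrite fourierT_periodization.
split; first by move=> f sf x; have [A] := schwartz_wbounded x sf;
  exact: abs_summable_weight.
split; first exact: periodization_smooth.
split; first exact: periodization_surj.
split; first exact: L1norm_periodization.
split=> f sf; have tP := periodization_smooth sf; rewrite ?F//.
  split; first exact: fourierT_schwartzZ.
  (* The inverse is a choice of preimage in [smooth_torus]; injectivity there forces it to be the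
     periodization. *)
  move=> x; rewrite /fourierT_inv pinvKV//; last exact: mem_set.
  exact: fourierT_injective.
move=> x; have wT := schwartzZ_wbounded (fourierT_schwartzZ tP).
have E xi : fourierR f (ZnR R xi) = fourierT (periodization f) xi.
  by rewrite fourierT_periodization.
have eE : (fun xi => expi (dotp x (ZnR R xi)) * fourierR f (ZnR R xi)) =
    (fun xi => echar xi x * fourierT (periodization f) xi).
  by apply/funext => xi; rewrite E.
rewrite eE; split.
  by have [A] := echarM_wbounded x wT; exact: abs_summable_weight.
exact: (fourier_inversion tP x).
Qed.
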